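(* Let $\mathcal A$ be a maximal Banach operator ideal associated with a tensor norm $\alpha$. Let $1\le\lambda,\tilde\lambda<\infty$ and let $X$ be a Banach space. Then the following statements hold. (a) If $X$ has the $\alpha$-$\lambda$-BAP, then $X$ has the local $\lambda$-BAP for $\mathcal A^*$. (b) If $X$ has the local $\lambda$-BAP for $\mathcal A^*$ and $X^*$ has the $\alpha'$-$\tilde\lambda$-BAP, then $X$ has the $\alpha$-$\lambda\tilde\lambda$-BAP.
   Context: All Banach spaces are over the same field, real or complex. ''Tensor norm'' means a finitely generated uniform crossnorm (Ryan's terminology; a ''finitely generated tensor norm'' in the Defant–Floret terminology). Elements of $X^*\otimes Y$ are identified with finite rank operators in $\mathcal F(X;Y)$. A maximal Banach operator ideal $\mathcal A$ and a tensor norm $\alpha$ are associated if $\mathcal A(M;N)=M^*\otimes_\alpha N$ isometrically for all finite-dimensional normed spaces $M,N$; this is a bijective correspondence between maximal Banach operator ideals and tensor norms. $\alpha^t$ is the transpose of $\alpha$: $\alpha^t(\sum x_j\otimes y_j;X,Y)=\alpha(\sum y_j\otimes x_j;Y,X)$. $\alpha'$ is the dual tensor norm: the (finitely generated) tensor norm with $M\otimes_{\alpha'}N=(M^*\otimes_\alpha N^* )^*$ isometrically for finite-dimensional $M,N$. Put $\alpha^*=(\alpha')^t=(\alpha^t)'$. $\mathcal A^*$ is the adjoint Banach operator ideal of $\mathcal A$; it is the maximal Banach operator ideal associated with $\alpha^*$. For a tensor norm $\alpha$ and $1\le\lambda<\infty$, a Banach space $X$ has the $\alpha$-$\lambda$-BAP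 (bounded $\alpha$-approximation property with constant $\lambda$) if for every Banach space $Y$ the natural mapping $\jmath\colon Y^*\otimes_\alpha X\to(Y\otimes_{\alpha'}X^* )^*$ satisfies $\alpha(u)\le\lambda\|\jmath(u)\|$ for all $u\in Y^*\otimes X$. Equivalently, if $\alpha$ is associated with the maximal ideal $\mathcal A$: for every Banach space $Y$ and every $S\in\mathcal F(Y;X)$, $\alpha(S)\le\lambda\|S\|_{\mathcal A(Y;X)}$. For a Banach operator ideal $\mathcal B$, $X$ has the local $\lambda$-BAP for $\mathcal B$ if for every Banach space $Y$ and each $T\in\mathcal B(X;Y)$ there is a net $(T_\nu)$ in $\mathcal F(X;Y)$ such that $T_\nu\to T$ pointwise and $\limsup_\nu\|T_\nu\|_{\mathcal B}\le\lambda\|T\|_{\mathcal B}$. *)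

(* Defs.v *)
From HB Require Import structures.
From mathcomp Require Import all_boot all_order all_algebra.
From mathcomp Require Import sesquilinear.
From mathcomp Require Import complex.
From mathcomp Require Import all_classical all_reals.
From mathcomp Require Import ereal topology normedtype sequences.

Set Implicit Arguments.
Unset Strict Implicit.
Unset Printing Implicit Defensive.

Import Order.TTheory GRing.Theory Num.Def Num.Theory.
Import numFieldNormedType.Exports.

Local Open Scope classical_set_scope.
Local Open Scope ring_scope.

Variant scalar_kind := RealScalars | ComplexScalars.

Definition scalar_field (R : realType) (k : scalar_kind) : numFieldType :=
  match k with
  | RealScalars => R
  | ComplexScalars => R[i]
  end.

(* The norm of a normed module over [scalar_field R k] takes its values in the
   nonnegative elements of [scalar_field R k]; [rpart] and [rembed] identify the
   real elements of [scalar_field R k] with [R]. *)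
Definition rpart (R : realType) (k : scalar_kind) : scalar_field R k -> R :=
  match k with
  | RealScalars => fun x => x
  | ComplexScalars => fun z => complex.Re z
  end.

Definition rembed (R : realType) (k : scalar_kind) : R -> scalar_field R k :=
  match k with
  | RealScalars => fun x => x
  | ComplexScalars => fun x => (x%:C)%C
  end.

Section ScalarTheory.
Context (R : realType) (k : scalar_kind).
Local Notation K := (scalar_field R k).

Lemma rembedK (x : R) : rpart (rembed k x) = x.
Proof. by case: k. Qed.

Lemma rpartK (z : K) : 0 <= z -> rembed k (rpart z) = z.
Proof.
case: k z => //= -[a b]; rewrite lecE /= => /andP[/eqP b0 _].
by rewrite b0.
Qed.

Lemma rembed_le (x y : R) : (rembed k x <= rembed k y) = (x <= y).
Proof. by case: k => //=; rewrite lecR. Qed.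

Lemma rembed0 : rembed k 0 = 0 :> K.
Proof. by case: k. Qed.

Lemma rembedD (x y : R) : rembed k (x + y) = rembed k x + rembed k y.
Proof. by case: k => //=; rewrite rmorphD. Qed.

Lemma rembedM (x y : R) : rembed k (x * y) = rembed k x * rembed k y.
Proof. by case: k => //=; rewrite rmorphM. Qed.

Lemma scalar_complete (F : set_system K^o) :
  ProperFilter F -> cauchy F -> cvg F.
Proof.
case: k F => /= [F FF cF|F FF cF]; first exact: (@R_complete R F FF cF).
have Fball (e : R) : 0 < e ->
    exists2 A, F A & forall z w, A z -> A w -> `|z - w| < e%:C%C.
  move=> e0; move/cauchy_ballP : cF => /(_ (e%:C)%C).
  have e0' : 0 < (e%:C)%C :> R[i] by rewrite ltcR.
  move=> /(_ e0')[[A B]/= [FA FB] AB]; exists (A `&` B); first exact: filterI.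
  move=> z w [Az _] [_ Bw].
  by have /= := AB (z, w) (conj Az Bw); rewrite -ball_normE.
have Rcvg (g : R[i] -> R) : (forall z w, `|g z - g w|%:C%C <= `|z - w|) ->
    cvg ((g @ F) : set_system R).
  move=> gl; apply: R_complete; apply/cauchy_ballP => e e0.
  have [A FA Ae] := Fball e e0.
  exists (g @` A, g @` A).
    by split; exact: (filterS (@preimage_image _ _ g A) FA).
  move=> [_ _] [/= [z Az <-] [w Aw <-]]; rewrite -ball_normE /=.
  by rewrite -ltcR; exact: le_lt_trans (gl z w) (Ae z w Az Aw).
have /cvg_ex[a Fa] : cvg ((@complex.Re R @ F) : set_system R).
  by apply: Rcvg => z w; rewrite -raddfB; exact: normc_ge_Re.
have /cvg_ex[b Fb] : cvg ((@complex.Im R @ F) : set_system R).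
  apply: Rcvg => z w; rewrite -raddfB.
  case: (z - w) => x y; rewrite normc_def lecR /=.
  by rewrite -[`|y|]sqrtr_sqr ler_wsqrtr// lerDr sqr_ge0.
apply/cvg_ex; exists (a +i* b)%C; apply/cvgrPdist_le => e e0.
have re : e = ((complex.Re e)%:C)%C.
  by case: (e) e0 => x y; rewrite ltcE /= => /andP[/eqP -> _].
set r := complex.Re e in re.
have r0 : 0 < r by rewrite re ltcR in e0.
have r2 : 0 < r / 2 by rewrite divr_gt0.
move/cvgrPdist_le : Fa => /(_ _ r2) Fa; move/cvgrPdist_le : Fb => /(_ _ r2) Fb.
have key (z : R[i]) : `|a - complex.Re z| <= r / 2 ->
    `|b - complex.Im z| <= r / 2 -> `|(a +i* b)%C - z| <= e.
  case: z => x y /= za zb; rewrite re.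
  apply: (@le_trans _ _ ((`|a - x| + `|b - y|)%:C%C)); last first.
    by rewrite lecR (splitr r) lerD.
  rewrite normc_def lecR /=.
  rewrite -[leRHS]ger0_norm ?addr_ge0// -[leRHS]sqrtr_sqr ler_wsqrtr//.
  rewrite [leRHS]sqrrD !real_normK ?num_real//.
  by rewrite addrAC lerDl mulrn_wge0// mulr_ge0.
by near=> z; apply: key; near: z.
Unshelve. all: by end_near. Qed.

End ScalarTheory.

(* The scalar field as a Banach space over itself: a copy of
   [(scalar_field R k)^o], on which a [completeNormedModType] instance for the
   generic [k] would clash with the one for [realType]. *)
Definition scalar_space (R : realType) (k : scalar_kind) :=
  (scalar_field R k)^o.

HB.instance Definition _ (R : realType) (k : scalar_kind) :=
  NormedModule.copy (scalar_space R k) (scalar_field R k)^o.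
HB.instance Definition _ (R : realType) (k : scalar_kind) :=
  Uniform_isComplete.Build (scalar_space R k) (@scalar_complete R k).

Section BoundedOperators.
Context (R : realType) (k : scalar_kind).
Local Notation K := (scalar_field R k).

Definition rnorm (V : normedModType K) (x : V) : R := rpart `|x|.

Lemma rnormE (V : normedModType K) (x : V) : rembed k (rnorm x) = `|x|.
Proof. by rewrite rpartK. Qed.

Lemma rnorm_le (V W : normedModType K) (x : V) (y : W) :
  (rnorm x <= rnorm y) = (`|x| <= `|y|).
Proof. by rewrite -(rembed_le k) !rnormE. Qed.

Lemma rnorm_ge0 (V : normedModType K) (x : V) : 0 <= rnorm x.
Proof. by rewrite -(rembed_le k) rembed0 rnormE. Qed.

Lemma rnormD (V : normedModType K) (x y : V) :
  rnorm (x + y) <= rnorm x + rnorm y.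
Proof. by rewrite -(rembed_le k) rembedD !rnormE ler_normD. Qed.

Lemma rembed_inj : injective (rembed k : R -> K).
Proof. by move=> x y /(congr1 (@rpart R k)); rewrite !rembedK. Qed.

Lemma rnormZ (V : normedModType K) (a : K) (x : V) :
  rnorm (a *: x) = rpart `|a| * rnorm x.
Proof. by apply: rembed_inj; rewrite rembedM !rnormE normrZ. Qed.

Lemma rnorm0 (V : normedModType K) : rnorm (0 : V) = 0.
Proof. by apply: rembed_inj; rewrite rnormE normr0 rembed0. Qed.

Lemma rnorm0_eq0 (V : normedModType K) (x : V) : rnorm x = 0 -> x = 0.
Proof.
move=> /(congr1 (rembed k)); rewrite rnormE rembed0 => /eqP.
by rewrite normr_eq0 => /eqP.
Qed.

Section OperatorType.
Context (X Y : normedModType K).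

Definition continuous_linear : {pred X -> Y} :=
  fun f => `[< linear f /\ continuous f >].

Lemma continuous_linear_submod : submod_closed continuous_linear.
Proof.
split.
  apply/asboolP; split; last by move=> x; exact: cvg_cst.
  by move=> a x y /=; rewrite scaler0 addr0.
move=> a f g /asboolP[fl fc] /asboolP[gl gc]; apply/asboolP; split.
  move=> b x y; rewrite !fctE fl gl !scalerDr !scalerA (mulrC a) -!addrA.
  by congr (_ + _); rewrite addrCA.
by move=> x; apply: cvgD; [apply: cvgZl_tmp; exact: fc|exact: gc].
Qed.

HB.instance Definition _ := GRing.isSubmodClosed.Build K (X -> Y)
  continuous_linear continuous_linear_submod.

Record operator := MkOperator {
  op_fun :> X -> Y;
  op_funP : op_fun \in continuous_linear }.

HB.instance Definition _ := [isSub for op_fun].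
HB.instance Definition _ := [Choice of operator by <:].
HB.instance Definition _ := [SubChoice_isSubLmodule of operator by <:].

Lemma op_linear (T : operator) : linear T.
Proof. by have /asboolP[] := op_funP T. Qed.

Lemma op_continuous (T : operator) : continuous T.
Proof. by have /asboolP[] := op_funP T. Qed.

HB.instance Definition _ (T : operator) :=
  GRing.isLinear.Build K X Y *:%R (op_fun T) (@op_linear T).

Definition opnorm (T : operator) : R :=
  sup [set rnorm (T x) | x in [set x | rnorm x <= 1]].

Lemma op_bounded (T : operator) :
  exists2 C, 0 <= C & forall x, rnorm (T x) <= C * rnorm x.
Proof.
have /linear_bounded_continuous/linear_boundedP/pinfty_ex_gt0[M M0 MT] :
  continuous T := @op_continuous T.
have M0' : 0 <= M := ltW M0; exists (@rpart R k M).
  by rewrite -(rembed_le k) rembed0 (rpartK M0').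
by move=> x; rewrite -(rembed_le k) rembedM !rnormE (rpartK M0'); exact: MT.
Qed.

Lemma opnorm_has_sup (T : operator) :
  has_sup [set rnorm (T x) | x in [set x | rnorm x <= 1]].
Proof.
split; first by exists (rnorm (T 0)), 0 => //=; rewrite rnorm0.
have [C C0 TC] := op_bounded T; exists C => _ [x /= x1 <-].
by rewrite (le_trans (TC x))// ler_piMr.
Qed.

Lemma opnorm_ge0 (T : operator) : 0 <= opnorm T.
Proof.
apply: (@le_trans _ _ (rnorm (T 0))); first exact: rnorm_ge0.
by apply: (sup_upper_bound (opnorm_has_sup T)); exists 0 => //=; rewrite rnorm0.
Qed.

Lemma opnormP (T : operator) (x : X) : rnorm (T x) <= opnorm T * rnorm x.
Proof.
have [->|x0] := eqVneq x 0; first by rewrite linear0 !rnorm0 mulr0.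
have nx0 : 0 < rnorm x.
  rewrite lt_neqAle rnorm_ge0 andbT eq_sym; apply: contra x0 => /eqP.
  by move=> /rnorm0_eq0 ->.
pose c := rembed k (rnorm x)^-1.
have nc : rpart `|c| = (rnorm x)^-1.
  by rewrite ger0_norm ?rembedK// -rembed0 rembed_le invr_ge0 ltW.
rewrite -ler_pdivrMr// mulrC -nc -rnormZ -linearZ.
apply: (sup_upper_bound (opnorm_has_sup T)); exists (c *: x) => //=.
by rewrite rnormZ nc mulVf ?gt_eqF.
Qed.

Lemma opnorm_le (T : operator) (C : R) : 0 <= C ->
  (forall x, rnorm (T x) <= C * rnorm x) -> opnorm T <= C.
Proof.
move=> C0 TC; apply: ge_sup; first exact: (opnorm_has_sup T).1.
by move=> _ [x /= x1 <-]; rewrite (le_trans (TC x))// ler_piMr.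
Qed.

Lemma opnormD (S T : operator) : opnorm (S + T) <= opnorm S + opnorm T.
Proof.
apply: opnorm_le; first by rewrite addr_ge0 ?opnorm_ge0.
move=> x; rewrite (le_trans (rnormD (S x) (T x)))// mulrDl.
by rewrite lerD ?opnormP.
Qed.

Lemma opnormZ_le (a : K) (T : operator) :
  opnorm (a *: T) <= rpart `|a| * opnorm T.
Proof.
apply: opnorm_le; first by rewrite mulr_ge0 ?opnorm_ge0 ?(@rnorm_ge0 K^o).
by move=> x; rewrite rnormZ -mulrA ler_wpM2l ?(@rnorm_ge0 K^o) ?opnormP.
Qed.

Lemma opnormZ (a : K) (T : operator) :
  opnorm (a *: T) = rpart `|a| * opnorm T.
Proof.
apply/eqP; rewrite eq_le opnormZ_le/=.
have [->|a0] := eqVneq a 0.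
  by have -> : rpart `|0 : K| = 0 := rnorm0 K^o; rewrite mul0r opnorm_ge0.
have na0 : rpart `|a| * rpart `|a^-1| = 1.
  apply: (@rembed_inj); rewrite rembedM !rpartK//.
  by rewrite -normrM divff// normr1; case: k.
rewrite -{1}(scale1r T) -(mulVf a0) -scalerA.
apply: (@le_trans _ _ (rpart `|a| * (rpart `|a^-1| * opnorm (a *: T)))).
  by rewrite ler_wpM2l ?(@rnorm_ge0 K^o) ?opnormZ_le.
by rewrite mulrA na0 mul1r.
Qed.

Lemma opnorm0_eq0 (T : operator) : opnorm T = 0 -> T = 0.
Proof.
move=> T0; apply/val_inj/funext => x /=; apply: rnorm0_eq0.
by apply/eqP; rewrite eq_le rnorm_ge0 andbT (le_trans (opnormP T x))// T0 mul0r.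
Qed.

Let knorm (T : operator) : K := rembed k (opnorm T).

Let knormD (S T : operator) : knorm (S + T) <= knorm S + knorm T.
Proof. by rewrite -rembedD rembed_le opnormD. Qed.

Let knormZ (a : K) (T : operator) : knorm (a *: T) = `|a| * knorm T.
Proof. by rewrite /knorm opnormZ rembedM rpartK. Qed.

Let knorm0_eq0 (T : operator) : knorm T = 0 -> T = 0.
Proof. by rewrite /knorm -rembed0 => /rembed_inj/opnorm0_eq0. Qed.

HB.instance Definition _ :=
  Lmodule_isNormed.Build K operator knormD knormZ knorm0_eq0.

Lemma rnorm_operator (T : operator) : rnorm T = opnorm T.
Proof. by rewrite /rnorm rembedK. Qed.

Lemma norm_op (T : operator) (x : X) : `|T x| <= `|T| * `|x|.
Proof. by rewrite -!rnormE -rembedM rembed_le rnorm_operator opnormP. Qed.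

Lemma norm_op_le (T : operator) (C : K) : 0 <= C ->
  (forall x, `|T x| <= C * `|x|) -> `|T| <= C.
Proof.
move=> C0 TC; rewrite -rnormE -(rpartK C0) rembed_le rnorm_operator.
apply: opnorm_le => [|x]; first by rewrite -(rembed_le k) rembed0 rpartK.
by rewrite -(rembed_le k) rembedM !rnormE rpartK; first exact: TC.
Qed.

Lemma bounded_continuous_linear (f : X -> Y) (C : K) : linear f ->
  0 <= C -> (forall x, `|f x| <= C * `|x|) -> f \in continuous_linear.
Proof.
move=> fl C0 fC; apply/asboolP; split => //.
pose fL := GRing.isLinear.Build K X Y *:%R f fl.
pose g : {linear X -> Y} := HB.pack f fL.
have gb : bounded_near g (nbhs (0 : X)).
  apply/bounded_funP => r; exists (C * r) => x xr.
  by rewrite (le_trans (fC x))// ler_wpM2l.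
exact: (bounded_linear_continuous gb).
Qed.

End OperatorType.

Section OperatorComplete.
Context (X : normedModType K) (Y : completeNormedModType K).

Lemma operator_complete (F : set_system (operator X Y)) :
  ProperFilter F -> cauchy F -> cvg F.
Proof.
move=> FF cF.
have small (e : K) : 0 < e ->
    exists2 A, F A & forall S T, A S -> A T -> `|S - T| < e.
  move=> e0; move/cauchy_ballP : cF => /(_ e e0)[[A B]/= [FA FB] AB].
  exists (A `&` B); first exact: filterI.
  move=> S T [AS _] [_ BT].
  by have /= := AB (S, T) (conj AS BT); rewrite -ball_normE.
have cvgx (x : X) : cvg ((fun T : operator X Y => T x) @ F).
  apply: cauchy_cvg; apply/cauchy_ballP => e e0.
  have x0 : 0 < `|x| + 1 by rewrite ltr_wpDl.
  have [A FA Ae] := small _ (divr_gt0 e0 x0).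
  set ev := fun T : operator X Y => T x.
  exists (ev @` A, ev @` A).
    by split; exact: (filterS (@preimage_image _ _ ev A) FA).
  move=> [_ _] [/= [S AS <-] [T AT <-]]; rewrite -ball_normE /=.
  have := norm_op (S - T) x; rewrite /ev /=; move/le_lt_trans; apply.
  rewrite (@le_lt_trans _ _ (`|S - T| * (`|x| + 1)))//.
    by rewrite ler_wpM2l// lerDl.
  by rewrite -ltr_pdivlMr// Ae.
pose g x := lim ((fun T : operator X Y => T x) @ F).
have gP x : (fun T : operator X Y => T x) @ F --> g x by exact: cvgx.
have gl : linear g.
  move=> a x y; apply: (cvg_lim (@norm_hausdorff _ _)).
  under eq_fun do rewrite linearP.
  by apply: cvgD; [apply: cvgZl_tmp; exact: gP|exact: gP].
have close (e : K) A S x : F A -> A S ->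
    (forall S T, A S -> A T -> `|S - T| < e) -> `|S x - g x| <= e * `|x|.
  move=> FA AS Ae; apply/ler_addgt0Pr => d d0.
  have /cvgrPdist_lt/(_ d d0) gx := gP x.
  have [T [AT Td]] := @filter_ex _ F _ _ (filterI FA gx).
  rewrite -[_ - _](subrKA (T x)) (le_trans (ler_normD _ _))// lerD//.
    by rewrite (le_trans (norm_op (S - T) x))// ler_wpM2r// ltW// Ae.
  by rewrite distrC ltW.
have [A FA A1] := small 1 ltr01.
have [S AS] := @filter_ex _ F _ _ FA.
have C0 : 0 <= `|S| + 1 by rewrite addr_ge0.
have gC x : `|g x| <= (`|S| + 1) * `|x|.
  rewrite -[g x](subrK (S x)) (le_trans (ler_normD _ _))// distrC.
  by rewrite addrC mulrDl lerD// ?norm_op// (close 1 A S x).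
pose G := MkOperator (bounded_continuous_linear gl C0 gC).
apply/cvg_ex; exists G; apply/cvgrPdist_le => e e0.
have [B FB Be] := small e e0.
apply: (filterS _ FB) => T BT; rewrite distrC.
apply: norm_op_le; first exact: ltW.
by move=> x; exact: (close e B T x).
Qed.

HB.instance Definition _ :=
  Uniform_isComplete.Build (operator X Y) operator_complete.

End OperatorComplete.
End BoundedOperators.


Section Tensors.
Context (R : realType) (k : scalar_kind).
Local Notation K := (scalar_field R k).
Local Notation KS := (scalar_space R k).
Local Notation form X Y := {bilinear X -> Y -> KS}.

Section TensorType.
Context (X Y : lmodType K).

(* The algebraic tensor product is realized as the space of linear functionals
   on the bilinear forms spanned by the evaluations [B |-> B x y]. *)
Definition tensor_eval (s : seq (X * Y)) (B : form X Y) : KS :=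
  \sum_(p <- s) B p.1 p.2.

Definition is_tensor : {pred form X Y -> KS} :=
  fun u => `[< exists s, u = tensor_eval s >].

Lemma is_tensor_submod : submod_closed is_tensor.
Proof.
split.
  apply/asboolP; exists [::]; apply/funext => B.
  by rewrite /tensor_eval big_nil.
move=> a u v /asboolP[s ->] /asboolP[t ->]; apply/asboolP.
exists ([seq (a *: p.1, p.2) | p <- s] ++ t); apply/funext => B.
rewrite /tensor_eval big_cat big_map !fctE scaler_sumr; congr (_ + _).
by apply: eq_bigr => p _; rewrite linearZl_LR.
Qed.

HB.instance Definition _ := GRing.isSubmodClosed.Build K (form X Y -> KS)
  is_tensor is_tensor_submod.

Record tensor := MkTensor {
  tensor_fun :> form X Y -> KS;
  tensor_funP : tensor_fun \in is_tensor }.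

HB.instance Definition _ := [isSub for tensor_fun].
HB.instance Definition _ := [Choice of tensor by <:].
HB.instance Definition _ := [SubChoice_isSubLmodule of tensor by <:].

Lemma tensorE (u : tensor) : exists s, forall B, u B = tensor_eval s B.
Proof. by have /asboolP[s us] := tensor_funP u; exists s => B; rewrite us. Qed.

Lemma tens_subproof x y : (fun B : form X Y => B x y) \in is_tensor.
Proof.
apply/asboolP; exists [:: (x, y)]; apply/funext => B.
by rewrite /tensor_eval big_seq1.
Qed.

Definition tens x y : tensor := MkTensor (tens_subproof x y).

End TensorType.

Section TensorMap.
Context (X Y X' Y' : completeNormedModType K).
Context (S : operator X X') (T : operator Y Y').

Definition form_comp (B : form X' Y') (x : X) (y : Y) : KS := B (S x) (T y).

Lemma form_comp_bilinear (B : form X' Y') :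
  bilinear_for *:%R *:%R (form_comp B).
Proof.
by split=> z a x y; rewrite /form_comp linearP ?linearPl ?linearPr.
Qed.

HB.instance Definition _ (B : form X' Y') :=
  bilinear_isBilinear.Build K X Y KS *:%R *:%R (form_comp B)
    (form_comp_bilinear B).

Lemma tensor_map_subproof (u : tensor X Y) :
  (fun B : form X' Y' => u (form_comp B)) \in is_tensor (X:=X') (Y:=Y').
Proof.
have [s us] := tensorE u; apply/asboolP.
exists [seq (S p.1, T p.2) | p <- s]; apply/funext => B.
by rewrite us /tensor_eval big_map.
Qed.

Definition tensor_map (u : tensor X Y) : tensor X' Y' :=
  MkTensor (tensor_map_subproof u).

End TensorMap.

Section TensorSwap.
Context (X Y : lmodType K).

Definition form_flip (B : form Y X) (x : X) (y : Y) : KS := B y x.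

Lemma form_flip_bilinear (B : form Y X) :
  bilinear_for *:%R *:%R (form_flip B).
Proof. by split=> z a x y; rewrite /form_flip ?linearPl ?linearPr. Qed.

HB.instance Definition _ (B : form Y X) :=
  bilinear_isBilinear.Build K X Y KS *:%R *:%R (form_flip B)
    (form_flip_bilinear B).

Lemma tensor_swap_subproof (u : tensor X Y) :
  (fun B : form Y X => u (form_flip B)) \in is_tensor (X:=Y) (Y:=X).
Proof.
have [s us] := tensorE u; apply/asboolP.
exists [seq (p.2, p.1) | p <- s]; apply/funext => B.
by rewrite us /tensor_eval big_map.
Qed.

Definition tensor_swap (u : tensor X Y) : tensor Y X :=
  MkTensor (tensor_swap_subproof u).

End TensorSwap.

Section FormProduct.
Context (X Y : lmodType K).

Definition form_prod (f : X -> KS) (g : Y -> KS) (x : X) (y : Y) : KS :=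
  (f x : K) * (g y : K).

Lemma form_prod_bilinear (f : {linear X -> KS}) (g : {linear Y -> KS}) :
  bilinear_for *:%R *:%R (form_prod f g).
Proof.
split=> z a x y; rewrite /form_prod linearP.
  by rewrite mulrDl -mulrA.
by rewrite mulrDr mulrCA.
Qed.

HB.instance Definition _ (f : {linear X -> KS}) (g : {linear Y -> KS}) :=
  bilinear_isBilinear.Build K X Y KS *:%R *:%R (form_prod f g)
    (form_prod_bilinear f g).

End FormProduct.

Section TensorPairing.
Context (X X' Y Y' : lmodType K) (b : form X X') (c : form Y Y').

Definition pairing_form (v : tensor X' Y') (x : X) (y : Y) : KS :=
  v (form_prod (b x) (c y)).

Lemma pairing_form_bilinear (v : tensor X' Y') :
  bilinear_for *:%R *:%R (pairing_form v).
Proof.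
have [s vs] := tensorE v.
split=> z a x y;
  rewrite /= /pairing_form !vs /tensor_eval scaler_sumr -big_split;
  apply: eq_bigr => p _; rewrite /= /form_prod ?linearPl ?linearPr.
  by rewrite mulrDl -mulrA.
by rewrite mulrDr mulrCA.
Qed.

HB.instance Definition _ (v : tensor X' Y') :=
  bilinear_isBilinear.Build K X Y KS *:%R *:%R (pairing_form v)
    (pairing_form_bilinear v).

(* The bilinear pairing with
   [pairing (tens x y) (tens x' y') = b x x' * c y y']. *)
Definition pairing (u : tensor X Y) (v : tensor X' Y') : KS :=
  u (pairing_form v).

Lemma pairing_tens x y x' y' :
  pairing (tens x y) (tens x' y') = (b x x' : K) * (c y y' : K).
Proof. by []. Qed.

End TensorPairing.

Definition dual (X : completeNormedModType K) : completeNormedModType K :=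
  operator X KS.

Section Evaluation.
Context (X : completeNormedModType K).

Definition ev (f : dual X) (x : X) : KS := op_fun f x.
Definition coev (x : X) (f : dual X) : KS := op_fun f x.

Lemma ev_bilinear : bilinear_for *:%R *:%R ev.
Proof. by split=> z a x y //; rewrite /ev linearP. Qed.

HB.instance Definition _ :=
  bilinear_isBilinear.Build K (dual X) X KS *:%R *:%R ev ev_bilinear.

Lemma coev_bilinear : bilinear_for *:%R *:%R coev.
Proof. by split=> z a x y //; rewrite /coev linearP. Qed.

HB.instance Definition _ :=
  bilinear_isBilinear.Build K X (dual X) KS *:%R *:%R coev coev_bilinear.

End Evaluation.
End Tensors.

Section Operators.
Context (R : realType) (k : scalar_kind).
Local Notation K := (scalar_field R k).
Local Notation KS := (scalar_space R k).
Implicit Types X Y Z : completeNormedModType K.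

Lemma op_id_subproof X : (id : X -> X) \in continuous_linear (X:=X) (Y:=X).
Proof. by apply/asboolP; split=> [a x y|x] //; exact: cvg_id. Qed.

Definition op_id X : operator X X := MkOperator (op_id_subproof X).

Lemma op_comp_subproof X Y Z (T : operator Y Z) (S : operator X Y) :
  T \o S \in continuous_linear (X:=X) (Y:=Z).
Proof.
apply/asboolP; split=> [a x y|x] /=; first by rewrite !linearP.
by apply: continuous_comp; exact: op_continuous.
Qed.

Definition op_comp X Y Z (T : operator Y Z) (S : operator X Y) : operator X Z :=
  MkOperator (op_comp_subproof T S).

Lemma rank_one_subproof X Y (f : dual X) (y : Y) :
  (fun x => (op_fun f x : K) *: y) \in continuous_linear (X:=X) (Y:=Y).
Proof.
apply/asboolP; split=> [a u v|x]; first by rewrite linearP scalerDl scalerA.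
have fx : (op_fun f : X -> K^o) @ x --> (op_fun f x : K^o).
  exact: (@op_continuous _ _ _ _ f).
by apply: (cvgZr_tmp fx).
Qed.

Definition rank_one X Y (f : dual X) (y : Y) : operator X Y :=
  MkOperator (rank_one_subproof f y).

Definition in_finite_span (V : lmodType K) (A : set V) : Prop :=
  exists n (e : 'I_n -> V),
    forall x, A x -> exists c : 'I_n -> K, x = \sum_(i < n) c i *: e i.

Definition finite_dim X : Prop := in_finite_span [set: X].

Definition finite_rank X Y (T : operator X Y) : Prop :=
  in_finite_span (range T).

Definition isometric_embedding X Y (I : operator X Y) : Prop :=
  forall x, rnorm (I x) = rnorm x.

Definition quotient_map X Y (Q : operator X Y) : Prop :=
  (forall y, exists x, Q x = y) /\
  forall y, rnorm y = inf [set rnorm x | x in [set x | Q x = y]].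

End Operators.

(* Finite-dimensional subspaces, and quotients by finite-codimensional closed
   subspaces, are presented up to isometry: by isometric embeddings from, and
   quotient maps onto, finite-dimensional Banach spaces. *)

Section TensorNorms.
Context (R : realType) (k : scalar_kind).
Local Notation K := (scalar_field R k).
Local Notation KS := (scalar_space R k).
Local Notation banach := (completeNormedModType K).

Definition tensor_family := forall X Y : banach,
  tensor X Y -> R.

Record uniform_crossnorm (alpha : tensor_family) : Prop := {
  crossnormD : forall (X Y : banach) (u v : tensor X Y),
    alpha X Y (u + v) <= alpha X Y u + alpha X Y v;
  crossnormZ : forall (X Y : banach) (a : K) (u : tensor X Y),
    alpha X Y (a *: u) = rpart `|a| * alpha X Y u;
  crossnorm0_eq0 : forall (X Y : banach) (u : tensor X Y),
    alpha X Y u = 0 -> u = 0;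
  crossnorm_tens : forall (X Y : banach) (x : X) (y : Y),
    alpha X Y (tens x y) <= rnorm x * rnorm y;
  crossnorm_dual : forall (X Y : banach) (f : dual X) (g : dual Y)
      (u : tensor X Y),
    rnorm (u (form_prod (op_fun f) (op_fun g)))
      <= opnorm f * opnorm g * alpha X Y u;
  crossnorm_map : forall (X Y X' Y' : banach) (S : operator X X')
      (T : operator Y Y') (u : tensor X Y),
    alpha X' Y' (tensor_map S T u) <= opnorm S * opnorm T * alpha X Y u }.

Definition finite_hull (g : tensor_family) : tensor_family := fun X Y u =>
  inf [set r | exists (M N : banach)
                 (I : operator M X) (J : operator N Y) (w : tensor M N),
         [/\ finite_dim M, finite_dim N,
             isometric_embedding I & isometric_embedding J] /\
         (tensor_map I J w = u /\ r = g M N w)].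

Definition finitely_generated (alpha : tensor_family) : Prop :=
  forall (X Y : banach) (u : tensor X Y), alpha X Y u = finite_hull alpha u.

Definition tensor_norm (alpha : tensor_family) : Prop :=
  uniform_crossnorm alpha /\ finitely_generated alpha.

Definition functional_norm (V : Type) (p : V -> R) (f : V -> KS) : \bar R :=
  ereal_sup [set (rnorm (f v))%:E | v in [set v | p v <= 1]].

(* The norm of [(dual M (x)_alpha dual N)^*] on [M (x) N]; it is used for
   finite-dimensional [M] and [N] only. *)
Definition dual_norm_fin (alpha : tensor_family) : tensor_family :=
  fun M N w => fine (functional_norm (alpha (dual M) (dual N))
                       (pairing (@coev R k M) (@coev R k N) w)).

Definition tensor_dual (alpha : tensor_family) : tensor_family :=
  finite_hull (dual_norm_fin alpha).

Definition tensor_transpose (alpha : tensor_family) : tensor_family :=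
  fun X Y u => alpha Y X (tensor_swap u).

(* The adjoint of a maximal ideal associated with [alpha] is the maximal ideal
   associated with [tensor_adjoint alpha]. *)
Definition tensor_adjoint (alpha : tensor_family) : tensor_family :=
  tensor_transpose (tensor_dual alpha).

(* [pairing ev coev u] is the functional [j u] on [Y (x) dual X], with
   [j (f (x) x) (y (x) g) = f y * g x]. *)
Definition bounded_approx (alpha : tensor_family) (lambda : R)
    (X : banach) : Prop :=
  forall (Y : banach) (u : tensor (dual Y) X),
    ((alpha (dual Y) X u)%:E <=
     lambda%:E * functional_norm (tensor_dual alpha (X:=Y) (Y:=dual X))
                   (pairing (@ev R k Y) (@coev R k X) u))%E.

End TensorNorms.

Section OperatorIdeals.
Context (R : realType) (k : scalar_kind).
Local Notation K := (scalar_field R k).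
Local Notation KS := (scalar_space R k).
Local Notation banach := (completeNormedModType K).

(* [ideal_norm T] is meaningful only for [T] in the ideal. *)
Record banach_ideal := BanachIdeal {
  in_ideal : forall X Y : banach, operator X Y -> Prop;
  ideal_norm : forall X Y : banach, operator X Y -> R;
  ideal_finite_rank : forall (X Y : banach) (T : operator X Y),
    finite_rank T -> in_ideal T;
  ideal_add : forall (X Y : banach) (S T : operator X Y),
    in_ideal S -> in_ideal T -> in_ideal (S + T);
  ideal_scale : forall (X Y : banach) (a : K) (T : operator X Y),
    in_ideal T -> in_ideal (a *: T);
  ideal_comp : forall (W X Y Z : banach) (U : operator Y Z)
      (T : operator X Y) (S : operator W X),
    in_ideal T -> in_ideal (op_comp U (op_comp T S));
  ideal_normD : forall (X Y : banach) (S T : operator X Y),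
    in_ideal S -> in_ideal T ->
    ideal_norm (S + T) <= ideal_norm S + ideal_norm T;
  ideal_normZ : forall (X Y : banach) (a : K) (T : operator X Y), in_ideal T ->
    ideal_norm (a *: T) = rpart `|a| * ideal_norm T;
  ideal_norm0_eq0 : forall (X Y : banach) (T : operator X Y), in_ideal T ->
    ideal_norm T = 0 -> T = 0;
  ideal_norm_comp : forall (W X Y Z : banach) (U : operator Y Z)
      (T : operator X Y) (S : operator W X), in_ideal T ->
    ideal_norm (op_comp U (op_comp T S))
      <= opnorm U * ideal_norm T * opnorm S;
  ideal_norm_id : ideal_norm (op_id KS) = 1;
  ideal_complete : forall (X Y : banach) (T : nat -> operator X Y),
    (forall n, in_ideal (T n)) ->
    (forall e, 0 < e -> exists N, forall m n, (N <= m)%N -> (N <= n)%N ->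
       ideal_norm (T m - T n) <= e) ->
    exists2 S, in_ideal S &
      forall e, 0 < e -> exists N, forall n, (N <= n)%N ->
        ideal_norm (T n - S) <= e }.

(* [A] coincides isometrically with its maximal hull: the reverse inequality
   for the supremum over [I] and [Q] is part of the ideal property. *)
Definition maximal_ideal (A : banach_ideal) : Prop :=
  forall (X Y : banach) (T : operator X Y) (C : R),
    (forall (M N : banach)
            (I : operator M X) (Q : operator Y N),
       finite_dim M -> finite_dim N ->
       isometric_embedding I -> quotient_map Q ->
       ideal_norm A (op_comp Q (op_comp T I)) <= C) ->
    in_ideal A T /\ ideal_norm A T <= C.

(* Every operator between finite-dimensional spaces has finite rank, hence is
   of the form [\sum_(p <- s) rank_one p.1 p.2] and lies in the ideal. *)
Definition associated (A : banach_ideal) (alpha : tensor_family R k) : Prop :=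
  forall M N : banach, finite_dim M -> finite_dim N ->
    forall s : seq (dual M * N),
      ideal_norm A (\sum_(p <- s) rank_one p.1 p.2)
        = alpha (dual M) N (\sum_(p <- s) tens p.1 p.2).

Record directed (D : Type) (le : D -> D -> Prop) : Prop := {
  directed_inhabited : exists i : D, True;
  directed_refl : forall i, le i i;
  directed_trans : forall i j l, le i j -> le j l -> le i l;
  directed_upper : forall i j, exists l, le i l /\ le j l }.

Definition net_filter (D : Type) (le : D -> D -> Prop) : set_system D :=
  filter_from [set: D] (fun i => [set j | le i j]).

Definition net_limsup (D : Type) (le : D -> D -> Prop) (f : D -> R) : \bar R :=
  ereal_inf [set ereal_sup [set (f j)%:E | j in [set j | le i j]]
            | i in [set: D]].

Definition local_bounded_approx (B : banach_ideal) (lambda : R)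
    (X : banach) : Prop :=
  forall (Y : banach) (T : operator X Y), in_ideal B T ->
    exists (D : Type) (le : D -> D -> Prop) (T_ : D -> operator X Y),
      [/\ directed le,
          forall j, finite_rank (T_ j),
          forall x, T_ j x @[j --> net_filter le] --> T x &
          (net_limsup le (fun j => ideal_norm B (T_ j))
             <= (lambda * ideal_norm B T)%:E)%E].

End OperatorIdeals.

(* Main.v *)
From HB Require Import structures.
Require Import Defs.
From mathcomp Require Import all_boot all_order all_algebra.
From mathcomp Require Import sesquilinear complex ring lra.
From mathcomp Require Import all_classical all_reals.
From mathcomp Require Import ereal topology normedtype.

Set Implicit Arguments.
Unset Strict Implicit.
Unset Printing Implicit Defensive.

Import Order.TTheory GRing.Theory Num.Def Num.Theory.
Import numFieldNormedType.Exports.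

Local Open Scope classical_set_scope.
Local Open Scope ring_scope.

(** The theorem is a statement about trace duality. An operator [T : X -> Z] acts
    on [Z^* (x) X] by the trace [f (x) x |-> f (T x)], and if [T] lies in the
    adjoint ideal this functional is bounded by its ideal norm times [alpha]
    ([ideal_trace_bound]); conversely a finite rank operator given by a tensor of
    [Y (x) X^*] has ideal norm at most the dual norm [alpha'] of that tensor
    ([ideal_norm_le_tensor_dual]). Both facts are the definition of association
    on finite-dimensional spaces, transported by the ideal property and by
    [duality_bound].

    If [X] has the bounded [alpha]-approximation property, an operator [T] of the
    ideal is approximated at finitely many points by convexity: on the tuples of
    values a functional that separates [T] from the finite rank operators of norm
    slightly above [lambda |T|] is a tensor [u] of [Y^* (x) X] whose trace with
    [T] is too large for the functional that [u] defines on [Y (x) X^*]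
    ([pointwise_approximation]). Finite sets of points and tolerances index the
    net.

    For the converse, [alpha u] is the value at [u] of a functional, which is the
    trace of an operator [T : X -> Y^{**}] in the unit ball of the adjoint ideal;
    membership uses maximality ([representing_operator_in_ideal]). The local
    approximation property replaces [T] by finite rank operators, that is by
    tensors [v] of [Y^{**} (x) X^*]. The approximation property of [X^*] bounds
    [alpha' v] by the norm of [v] as a functional for the double dual norm, which
    is at most the ideal norm ([bidual_functional_norm]), and finally the trace
    of [u] and [v] is bounded through the functional of [u] on [Y (x) X^*]
    ([bidual_extension_bound]).

    The three passages between a space and its bidual are one principle of local
    reflexivity, used in the dual form [local_reflexivity]: to bound finitely many
    evaluations of an operator from a finite-dimensional space into [X^{**}] it
    suffices to bound them for operators into [X]. Its proof, and the separation
    arguments above, rely on the Hahn-Banach theorem over the real or complex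
    scalars ([hahn_banach]), which is derived from minimal sublinear
    functionals. *)

(** * Scalars *)

Section Scalars.
Context (R : realType) (k : scalar_kind).
Local Notation K := (scalar_field R k).
Local Notation KS := (scalar_space R k).

Lemma rpartD (a b : K) : rpart (a + b) = rpart a + rpart b.
Proof. by case: k a b => //= a b; rewrite raddfD. Qed.

Lemma rpartN (a : K) : rpart (- a) = - rpart a.
Proof. by case: k a => //= a; rewrite raddfN. Qed.

Lemma rembedN (x : R) : rembed k (- x) = - rembed k x :> K.
Proof. by case: k => //=; rewrite rmorphN. Qed.

Lemma rpart0 : rpart (0 : K) = 0.
Proof. by rewrite -(rembed0 R k) rembedK. Qed.

Lemma rpart_rembedM (t : R) (a : K) : rpart (rembed k t * a) = t * rpart a.
Proof. by case: k a => //= -[a b]; rewrite /= mul0r subr0. Qed.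

Lemma rpart_le_norm (a : K) : rpart a <= rpart `|a|.
Proof.
case: k a => /= a; first exact: ler_norm.
suff H (b : R[i]) : complex.Re b <= complex.Re `|b| by exact: H.
case: b => x y; rewrite normc_def /= (le_trans (ler_norm x))//.
by rewrite -[`|x|]sqrtr_sqr ler_wsqrtr// lerDl sqr_ge0.
Qed.

Lemma rpart_norm_rembed (t : R) : 0 <= t -> rpart `|rembed k t| = t.
Proof. by move=> t0; rewrite ger0_norm ?rembedK// -(rembed0 R k) rembed_le. Qed.

Lemma rembed1 : rembed k 1 = 1 :> K.
Proof. by case: k. Qed.

Lemma rpart_norm1 : rpart `|1 : K| = 1.
Proof. by rewrite normr1 -rembed1 rembedK. Qed.

Lemma rpart_norm_ge0 (a : K) : 0 <= rpart `|a|.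
Proof. exact: (@rnorm_ge0 R k K^o). Qed.

Lemma rpart_normM (a b : K) : rpart `|a * b| = rpart `|a| * rpart `|b|.
Proof. exact: (@rnormZ R k K^o a b). Qed.

Lemma rpart_norm0 : rpart `|0 : K| = 0.
Proof. exact: (@rnorm0 R k K^o). Qed.

Lemma scalar_phase (z : K) : exists2 a : K, rpart `|a| = 1 & a * z = `|z|.
Proof.
have [->|z0] := eqVneq z 0.
  by exists 1; rewrite ?rpart_norm1// normr0 mulr0.
exists (`|z| / z); last by rewrite mulfVK.
by rewrite normrM normfV normr_id divff ?normr_eq0// -rpart_norm1 normr1.
Qed.

End Scalars.

(** * The Hahn-Banach theorem *)

Section Seminorms.
Context (R : realType) (k : scalar_kind).
Local Notation K := (scalar_field R k).
Local Notation KS := (scalar_space R k).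

Definition seminorm (V : lmodType K) (q : V -> R) : Prop :=
  (forall x y, q (x + y) <= q x + q y) /\
  (forall a x, q (a *: x) = rpart `|a| * q x).

Definition sublinear (V : lmodType K) (p : V -> R) : Prop :=
  (forall x y, p (x + y) <= p x + p y) /\
  (forall t x, 0 < t -> p (rembed k t *: x) <= t * p x).

Context (V : lmodType K).
Implicit Types p q : V -> R.

Lemma seminorm_sublinear q : seminorm q -> sublinear q.
Proof.
by move=> [qD qZ]; split => // t x t0; rewrite qZ rpart_norm_rembed// ltW.
Qed.

Lemma seminormN q x : seminorm q -> q (- x) = q x.
Proof.
move=> [_ qZ]; rewrite -scaleN1r qZ normrN.
by rewrite rpart_norm1 mul1r.
Qed.

Lemma seminorm_ge0 q x : seminorm q -> 0 <= q x.
Proof.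
move=> qs; have [qD qZ] := qs.
have := qD x (- x); rewrite subrr seminormN// -(scale0r 0) qZ rpart_norm0 mul0r.
by rewrite -mulr2n pmulrn_lge0.
Qed.

Lemma seminorm_of_le q : (forall x y, q (x + y) <= q x + q y) ->
  (forall a x, q (a *: x) <= rpart `|a| * q x) -> seminorm q.
Proof.
move=> qD qZ; split=> // a x; apply/eqP; rewrite eq_le qZ/=.
have [->|a0] := eqVneq a 0.
  rewrite rpart_norm0 mul0r scale0r.
  by have := qD 0 0; rewrite addr0 -subr_ge0 addrK.
have := qZ a^-1 (a *: x); rewrite scalerA mulVf// scale1r.
move=> /(ler_wpM2l (rpart_norm_ge0 a)) /le_trans; apply.
by rewrite mulrA -rpart_normM mulfV// rpart_norm1 mul1r.
Qed.

Lemma sublinearZ p t x : sublinear p -> 0 < t ->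
  p (rembed k t *: x) = t * p x.
Proof.
move=> [_ pZ] t0; apply/eqP; rewrite eq_le pZ//=.
have ti : 0 < t^-1 by rewrite invr_gt0.
rewrite mulrC -ler_pdivlMr// mulrC -{1}[x](scale1r) -rembed1.
by rewrite -(mulVf (lt0r_neq0 t0)) rembedM -scalerA pZ.
Qed.

Lemma sublinear0 p : sublinear p -> p 0 = 0.
Proof.
move=> ps; have := @sublinearZ p 2 0 ps (ltr0n _ 2).
rewrite scaler0 => /eqP; rewrite mulr_natl mulr2n -subr_eq0 opprD.
by rewrite addNKr oppr_eq0 => /eqP.
Qed.

Lemma sublinear_opp p x : sublinear p -> - p (- x) <= p x.
Proof.
move=> ps; rewrite -subr_ge0 opprK -(sublinear0 ps) -(subrr x).
exact: ps.1.
Qed.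

(** Lowering a sublinear functional by a convex cone of prescribed lower
    bounds: both the domination condition of the extension theorem and the
    additivity of minimal functionals come from this one infimum. *)
Lemma sublinear_lower p (G : set (V * R)) : sublinear p ->
  G (0, 0) ->
  (forall g h, G g -> G h -> G (g.1 + h.1, g.2 + h.2)) ->
  (forall t g, 0 < t -> G g -> G (rembed k t *: g.1, t * g.2)) ->
  (forall g, G g -> g.2 <= p g.1) ->
  exists2 p', sublinear p' & (forall x, p' x <= p x) /\
    (forall x g, G g -> p' x <= p (x + g.1) - g.2).
Proof.
move=> ps G0 GD GZ Gp.
pose A x := [set p (x + g.1) - g.2 | g in G].
have A0 x : A x !=set0 by exists (p (x + 0) - 0), (0, 0).
have Alb x : has_lbound (A x).
  exists (- p (- x)) => _ [g Gg <-].
  rewrite lerBrDr -lerBrDl opprK (le_trans (Gp _ Gg))//.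
  by have := ps.1 (x + g.1) (- x); rewrite addrAC subrr add0r.
have le x g : G g -> inf (A x) <= p (x + g.1) - g.2.
  by move=> Gg; apply: ge_inf => //; exists g.
exists (fun x => inf (A x)); last first.
  by split=> // x; have := le x _ G0; rewrite /= addr0 subr0.
split=> [x y|t x t0].
  rewrite -lerBlDr; apply: lb_le_inf => // _ [g Gg <-].
  rewrite lerBlDr -lerBlDl; apply: lb_le_inf => // _ [h Gh <-].
  rewrite lerBlDl; apply: le_trans (le _ _ (GD _ _ Gg Gh)) _.
  by rewrite /= [leRHS]addrACA -opprD lerD2r addrACA ps.1.
rewrite mulrC -ler_pdivrMr//; apply: lb_le_inf => // _ [g Gg <-].
rewrite ler_pdivrMr// mulrC; apply: le_trans (le _ _ (GZ _ _ t0 Gg)) _.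
by rewrite /= -scalerDr mulrBr lerD2r ps.2.
Qed.


(** Zorn's lemma: the pointwise infimum of a chain below [q] is finite because
    each member [p] satisfies [- q (- x) <= p x]. *)
Lemma minimal_sublinear q : sublinear q ->
  exists p, [/\ sublinear p, forall x, p x <= q x &
    forall p', sublinear p' -> (forall x, p' x <= p x) ->
      forall x, p x <= p' x].
Proof.
move=> qs; pose T := {p | sublinear p /\ forall x, p x <= q x}.
pose t0 : T := exist _ q (conj qs (fun x => lexx (q x))).
pose le (s t : T) := `[< forall x, sval t x <= sval s x >].
have [s|r s t /asboolP rs /asboolP st|A Atot|t tmax] := @ZL_preorder T t0 le.
- by apply/asboolP.
- by apply/asboolP => x; exact: le_trans (st x) (rs x).
- have [[a Aa]|A0] := pselect (exists a, A a); last first.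
    by exists t0 => s As; case: A0; exists s.
  pose P x := [set sval s x | s in A].
  have P0 x : P x !=set0 by exists (sval a x), a.
  have Plb x : has_lbound (P x).
    exists (- q (- x)) => _ [s As <-]; have [ss sq] := svalP s.
    by rewrite (le_trans _ (sublinear_opp x ss))// lerN2.
  have ile x s : A s -> inf (P x) <= sval s x.
    by move=> As; apply: ge_inf => //; exists s.
  suff infs : sublinear (fun x => inf (P x)).
    have iq x : inf (P x) <= q x.
      by rewrite (le_trans (ile x a Aa))//; exact: (svalP a).2.
    exists (exist _ (fun x => inf (P x)) (conj infs iq)) => s As.
    by apply/asboolP => x; exact: ile.
  split=> [x y|r x r0].
    rewrite -lerBlDr; apply: lb_le_inf => // _ [s As <-].
    rewrite lerBlDr -lerBlDl; apply: lb_le_inf => // _ [t At <-].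
    rewrite lerBlDl.
    have [/asboolP st|/asboolP ts] := Atot _ _ As At.
      rewrite (le_trans (ile _ _ At))// (le_trans ((svalP t).1.1 x y))//.
      by rewrite lerD2r.
    rewrite (le_trans (ile _ _ As))// (le_trans ((svalP s).1.1 x y))//.
    by rewrite lerD2l.
  rewrite mulrC -ler_pdivrMr//; apply: lb_le_inf => // _ [s As <-].
  by rewrite ler_pdivrMr// mulrC (le_trans (ile _ _ As))//; exact: (svalP s).1.2.
- have [ts tq] := svalP t; exists (sval t); split=> // p ps pt.
  have pq x : p x <= q x by exact: le_trans (pt x) (tq x).
  have /asboolP := tmax (exist _ p (conj ps pq)) (asboolT pt).
  by [].
Qed.

(** A minimal sublinear functional [p] is unchanged when it is lowered along a
    ray [t y] with prescribed values [t p(y)], which forces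
    [p(x) + p(y) <= p(x + y)]. *)
Lemma minimal_sublinear_additive p : sublinear p ->
  (forall p', sublinear p' -> (forall x, p' x <= p x) ->
    forall x, p x <= p' x) ->
  forall x y, p (x + y) = p x + p y.
Proof.
move=> ps pmin x y; apply/eqP; rewrite eq_le ps.1/=.
pose G := [set g | exists2 t, 0 <= t &
  g = (rembed k t *: y, t * p y) :> V * R].
have rp t z : 0 <= t -> p (rembed k t *: z) = t * p z.
  rewrite le_eqVlt => /predU1P[<-|t0]; last exact: sublinearZ.
  by rewrite rembed0 scale0r mul0r sublinear0.
have [| | | |p' p's [p'p p'G]] := @sublinear_lower p G ps.
- by exists 0; rewrite ?rembed0 ?scale0r ?mul0r.
- move=> _ _ [t t0 ->] [s s0 ->]; exists (t + s); first exact: addr_ge0.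
  by rewrite rembedD scalerDl mulrDl.
- move=> t _ t0 [s s0 ->]; exists (t * s); first by rewrite mulr_ge0// ltW.
  by rewrite /= scalerA -rembedM mulrA.
- by move=> _ [t t0 ->] /=; rewrite rp.
rewrite -lerBrDr (le_trans (pmin _ p's p'p x))//.
rewrite (le_trans (p'G x (rembed k 1 *: y, 1 * p y) _))//.
  by exists 1.
by rewrite /= rembed1 scale1r mul1r.
Qed.

End Seminorms.

(** Over the complex numbers the functional with real part [g] is
    [x |-> g x - i g (i x)], so the extension problem is a real one. *)
Lemma real_linear_lift (R : realType) (k : scalar_kind)
    (V : lmodType (scalar_field R k)) (g : V -> R) :
  (forall x y, g (x + y) = g x + g y) ->
  (forall t x, g (rembed k t *: x) = t * g x) ->
  exists2 psi : V -> scalar_space R k, linear psi &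
    forall x, rpart (psi x) = g x.
Proof.
case: k V g => V g gD gZ.
  by exists g => // a x y; rewrite gD gZ.
pose K := scalar_field R ComplexScalars.
pose im : K := (0 +i* 1)%C.
have im2 : im * im = -1.
  by apply/eqP; rewrite eq_complex /=; apply/andP; split; apply/eqP; ring.
have KE (a : K) : a = rembed _ (complex.Re a) + rembed _ (complex.Im a) * im.
  by apply/eqP; rewrite eq_complex /=; apply/andP; split; apply/eqP; ring.
have gE (a : K) z : g (a *: z) = complex.Re a * g z + complex.Im a * g (im *: z).
  by rewrite {1}[a]KE scalerDl gD -scalerA !gZ.
exists (fun x => (g x +i* (- g (im *: x)))%C) => // a x y.
have gi z : g (im *: (im *: z)) = - g z.
  by rewrite scalerA im2 gE /= !oppr0 mul0r addr0 mulN1r.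
rewrite gD scalerDr gD; have -> : im *: (a *: x) = a *: (im *: x).
  by rewrite !scalerA mulrC.
rewrite (gE a x) (gE a (im *: x)) gi; case: a => a b /=; apply/eqP; rewrite eq_complex /=.
by apply/andP; split; apply/eqP; ring.
Qed.

Section HahnBanach.
Context (R : realType) (k : scalar_kind).
Local Notation K := (scalar_field R k).
Local Notation KS := (scalar_space R k).

(** Applied to the values of two scalar-linear functionals, whose multiples are
    values again, this recovers the functionals from their real parts. *)
Lemma rpart_scalar_eq (a b : K) :
  (forall c : K, rpart (c * a) = rpart (c * b)) -> a = b.
Proof.
move=> ab; apply/eqP; rewrite -subr_eq0 -normr_eq0.
have [d _ dE] := scalar_phase (a - b).
rewrite -(rpartK (normr_ge0 (a - b))) -dE.
have := rpartD (d * (a - b)) (d * b); rewrite -mulrDr subrK ab => H.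
by have -> : rpart (d * (a - b)) = 0; [lra|rewrite rembed0].
Qed.

(** Lowering [q] by the constraints [psi (- L u) >= - Phi u] and passing to a
    minimal sublinear functional gives the real part of the extension; the
    modulus is controlled by rotating the value onto the positive axis. *)
Theorem hahn_banach (U V : lmodType K) (q : V -> R) (L : U -> V)
    (Phi : U -> KS) :
  seminorm q -> linear L -> linear Phi ->
  (forall u, rpart `|Phi u : K| <= q (L u)) ->
  exists psi : V -> KS, [/\ linear psi, forall u, psi (L u) = Phi u &
    forall x, rpart `|psi x : K| <= q x].
Proof.
move=> qs Ll Phil Phiq.
pose LL : {linear U -> V} := HB.pack L (GRing.isLinear.Build K U V *:%R L Ll).
pose PP : {linear U -> KS} :=
  HB.pack Phi (GRing.isLinear.Build K U KS *:%R Phi Phil).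
pose G := [set g | exists u, g = (- LL u, - rpart (PP u : K)) :> V * R].
have rP u v : rpart (PP (u + v) : K) = rpart (PP u : K) + rpart (PP v : K).
  by rewrite linearD rpartD.
have [| | | |p ps [pq pG]] := @sublinear_lower _ _ _ q G (seminorm_sublinear qs).
- by exists 0; rewrite !linear0 rpart0 !oppr0.
- move=> _ _ [u ->] [v ->]; exists (u + v).
  by rewrite rP linearD !opprD.
- move=> t _ t0 [u ->]; exists (rembed k t *: u).
  by rewrite !linearZ /= rpart_rembedM !scalerN mulrN.
- move=> _ [u ->] /=; rewrite seminormN// (le_trans _ (Phiq u))//.
  by rewrite -rpartN -normrN rpart_le_norm.
have [g [gs gp gmin]] := minimal_sublinear ps.
have gD := minimal_sublinear_additive gs gmin.
have g0 := sublinear0 gs.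
have gN x : g (- x) = - g x.
  by apply/eqP; rewrite -addr_eq0 -gD addNr g0.
have gZ t x : g (rembed k t *: x) = t * g x.
  have [t0|t0|<-] := ltgtP 0 t.
  - exact: sublinearZ.
  - by rewrite -[t]opprK rembedN scaleNr gN sublinearZ ?oppr_gt0//; ring.
  - by rewrite rembed0 scale0r mul0r.
have gL u : g (LL u) = rpart (PP u : K).
  have gle v : g (LL v) <= rpart (PP v : K).
    apply: le_trans (gp _) _.
    have Gv : G (- LL v, - rpart (PP v : K)) by exists v.
    have := pG (LL v) _ Gv.
    by rewrite /= subrr (sublinear0 (seminorm_sublinear qs)) sub0r opprK.
  apply/eqP; rewrite eq_le gle/=.
  by have := gle (- u); rewrite !linearN gN rpartN lerN2.
have [psi psil psig] := real_linear_lift gD gZ.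
pose QQ : {linear V -> KS} :=
  HB.pack psi (GRing.isLinear.Build K V KS *:%R psi psil).
exists psi; split=> // [u|x].
  apply: rpart_scalar_eq => c.
  have -> : c * (psi (L u) : K) = QQ (LL (c *: u)) by rewrite !linearZ.
  have -> : c * (Phi u : K) = PP (c *: u) by rewrite linearZ.
  by rewrite psig gL.
have [a a1 ax] := scalar_phase (psi x : K).
rewrite -ax; have -> : a * (psi x : K) = QQ (a *: x) by rewrite linearZ.
rewrite psig (le_trans (gp _))// (le_trans (pq _))//.
by rewrite qs.2 a1 mul1r.
Qed.

(** Extension from the line spanned by [x]. *)
Corollary seminorm_attained (V : lmodType K) (q : V -> R) (x : V) :
  seminorm q -> exists psi : V -> KS, [/\ linear psi,
    psi x = rembed k (q x) & forall y, rpart `|psi y : K| <= q y].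
Proof.
move=> qs; pose L (a : K^o) := (a : K) *: x.
pose Phi (a : K^o) : KS := (a : K) * rembed k (q x).
have [|||psi [psil psiL psiq]] := @hahn_banach _ V q L Phi qs.
- by move=> a u v; rewrite /L scalerDl scalerA.
- by move=> a u v; rewrite /Phi mulrDl -mulrA.
- move=> a; rewrite /Phi rpart_normM rpart_norm_rembed ?seminorm_ge0//.
  by rewrite /L qs.2.
exists psi; split => //.
by have := psiL (1 : K^o); rewrite /L /Phi scale1r mul1r.
Qed.

End HahnBanach.

Section InfConvolution.
Context (R : realType) (k : scalar_kind).
Local Notation K := (scalar_field R k).
Context (W V : lmodType K) (D : set W) (p : W -> R) (q : V -> R).
Context (L : {linear W -> V}).
Hypothesis D0 : D 0.
Hypothesis DD : forall x y, D x -> D y -> D (x + y).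
Hypothesis DZ : forall a x, D x -> D (a *: x).
Hypothesis p_ge0 : forall x, D x -> 0 <= p x.
Hypothesis pD : forall x y, D x -> D y -> p (x + y) <= p x + p y.
Hypothesis pZ : forall a x, D x -> p (a *: x) <= rpart `|a| * p x.
Hypothesis qs : seminorm q.

(** The largest seminorm below both [q] and the push-forward of [p] along [L];
    a functional that it dominates is bounded on the target by [q] and on the
    image of [D] by [p] at the same time. *)
Definition inf_convolution (z : V) : R :=
  inf [set p x + q (z - L x) | x in D].

Lemma inf_convolution_le z x : D x -> inf_convolution z <= p x + q (z - L x).
Proof.
move=> Dx; apply: ge_inf; last by exists x.
by exists 0 => _ [y Dy <-]; rewrite addr_ge0 ?p_ge0 ?seminorm_ge0.
Qed.

Lemma inf_convolution_ge z c :
  (forall x, D x -> c <= p x + q (z - L x)) -> c <= inf_convolution z.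
Proof.
move=> H; apply: lb_le_inf; first by exists (p 0 + q (z - L 0)), 0.
by move=> _ [x Dx <-]; exact: H.
Qed.

Lemma inf_convolution_seminorm : seminorm inf_convolution.
Proof.
apply: seminorm_of_le => [z w|a z].
  rewrite -lerBlDr; apply: inf_convolution_ge => x Dx.
  rewrite lerBlDr -lerBlDl; apply: inf_convolution_ge => y Dy.
  rewrite lerBlDl (le_trans (inf_convolution_le _ (DD Dx Dy)))//.
  rewrite linearD opprD [X in q X]addrACA [leRHS]addrACA lerD ?pD//.
  exact: qs.1.
have [->|a0] := eqVneq a 0.
  rewrite rpart_norm0 mul0r scale0r (le_trans (inf_convolution_le _ D0))//.
  rewrite linear0 subr0 -(scale0r 0) qs.2 rpart_norm0 mul0r addr0.
  by rewrite -(scale0r 0) (le_trans (pZ _ D0))// rpart_norm0 mul0r.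
have an : 0 < rpart `|a|.
  rewrite lt_neqAle rpart_norm_ge0 andbT eq_sym; apply: contra a0 => /eqP a0.
  by rewrite -normr_eq0 -(rpartK (normr_ge0 a)) a0 rembed0.
rewrite mulrC -ler_pdivrMr//; apply: inf_convolution_ge => x Dx.
rewrite ler_pdivrMr// (le_trans (inf_convolution_le _ (DZ a Dx)))//.
by rewrite linearZ -scalerBr qs.2 [leRHS]mulrC mulrDr lerD2r pZ.
Qed.

End InfConvolution.

(** * Operators and duals *)

Section Duality.
Context (R : realType) (k : scalar_kind).
Local Notation K := (scalar_field R k).
Local Notation KS := (scalar_space R k).
Implicit Types X Y Z : completeNormedModType K.

Lemma rnorm_scalar (a : KS) : rnorm a = rpart `|a : K|.
Proof. by []. Qed.

Lemma rnormN X (x : X) : rnorm (- x) = rnorm x.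
Proof. by rewrite /rnorm normrN. Qed.

Lemma rnorm_seminorm X : seminorm (@rnorm R k X).
Proof. by split=> [x y|a x]; [exact: rnormD|exact: rnormZ]. Qed.

Lemma op_of_bound X Y (f : X -> Y) (C : R) : linear f -> 0 <= C ->
  (forall x, rnorm (f x) <= C * rnorm x) ->
  exists2 T : operator X Y, (forall x, T x = f x) & opnorm T <= C.
Proof.
move=> fl C0 fC; have C0' : 0 <= rembed k C :> K.
  by rewrite -(rembed0 R k) rembed_le.
have fcl : f \in continuous_linear (X:=X) (Y:=Y).
  apply: (bounded_continuous_linear fl C0') => x.
  by rewrite -!rnormE -rembedM rembed_le.
by exists (MkOperator fcl) => //; apply: opnorm_le.
Qed.

Lemma norming_functional X (x : X) :
  exists2 f : dual X, opnorm f <= 1 & f x = rembed k (rnorm x).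
Proof.
have [psi [psil psix psib]] := seminorm_attained x (rnorm_seminorm X).
have psib1 y : rnorm (psi y) <= 1 * rnorm y by rewrite mul1r; exact: psib.
by have [f fE f1] := op_of_bound psil ler01 psib1; exists f; rewrite ?fE.
Qed.

Lemma opE (X Y : completeNormedModType K) (S T : operator X Y) :
  (forall x, S x = T x) -> S = T.
Proof. by move=> ST; apply/val_inj/funext. Qed.

Lemma op_sumE X Y I (s : seq I) (F : I -> operator X Y) x :
  op_fun (\sum_(i <- s) F i) x = \sum_(i <- s) F i x.
Proof. by elim/big_rec2: _ => //= i y T _ <-. Qed.

Lemma opnorm_comp X Y Z (T : operator Y Z) (S : operator X Y) :
  opnorm (op_comp T S) <= opnorm T * opnorm S.
Proof.
apply: opnorm_le => [|x]; first by rewrite mulr_ge0 ?opnorm_ge0.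
by rewrite (le_trans (opnormP T (S x)))// -mulrA ler_wpM2l ?opnorm_ge0 ?opnormP.
Qed.

Lemma opnorm_id X : opnorm (op_id X) <= 1.
Proof. by apply: opnorm_le => // x; rewrite mul1r. Qed.

Lemma opnorm_isometric X Y (I : operator X Y) :
  isometric_embedding I -> opnorm I <= 1.
Proof. by move=> Ii; apply: opnorm_le => // x; rewrite mul1r Ii. Qed.

Lemma eval_subproof X (x : X) :
  (fun f : dual X => (op_fun f x : KS)) \in continuous_linear (X:=dual X) (Y:=KS).
Proof.
apply: (@bounded_continuous_linear _ _ _ _ _ `|x|) => // f.
by rewrite mulrC; exact: norm_op.
Qed.

Definition eval_at X (x : X) : dual (dual X) := MkOperator (eval_subproof x).

Lemma eval_at_norm X (x : X) : rnorm (eval_at x) = rnorm x.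
Proof.
rewrite rnorm_operator; apply/eqP; rewrite eq_le; apply/andP; split.
  apply: opnorm_le => [|f]; first exact: rnorm_ge0.
  by rewrite mulrC rnorm_operator; exact: (opnormP f x).
have [f f1 fx] := norming_functional x.
have : rnorm (eval_at x f) <= opnorm (eval_at x) * rnorm f := opnormP _ _.
rewrite {1}/eval_at /= fx rnorm_scalar rpart_norm_rembed ?rnorm_ge0//.
move=> /le_trans; apply; rewrite ler_piMr ?opnorm_ge0//.
by rewrite rnorm_operator.
Qed.

Lemma bidual_subproof X :
  @eval_at X \in continuous_linear (X:=X) (Y:=dual (dual X)).
Proof.
apply: (@bounded_continuous_linear _ _ _ _ _ 1) => // [a x y|x].
  by apply: opE => f; rewrite /= linearP.
by rewrite mul1r -rnorm_le eval_at_norm.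
Qed.

Definition bidual X : operator X (dual (dual X)) :=
  MkOperator (@bidual_subproof X).

Lemma bidual_isometric X : isometric_embedding (bidual X).
Proof. exact: eval_at_norm. Qed.

Lemma adjoint_subproof X Y (T : operator X Y) :
  (fun f : dual Y => (op_comp f T : dual X))
    \in continuous_linear (X:=dual Y) (Y:=dual X).
Proof.
have T0 : 0 <= rembed k (opnorm T) :> K.
  by rewrite -(rembed0 R k) rembed_le opnorm_ge0.
apply: (bounded_continuous_linear _ T0) => [a f g|f].
  by apply: opE => x.
by rewrite -!rnormE -rembedM rembed_le !rnorm_operator mulrC opnorm_comp.
Qed.

Definition adjoint X Y (T : operator X Y) : operator (dual Y) (dual X) :=
  MkOperator (adjoint_subproof T).

Lemma opnorm_adjoint X Y (T : operator X Y) : opnorm (adjoint T) <= opnorm T.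
Proof.
apply: opnorm_le => [|f]; first exact: opnorm_ge0.
by rewrite !rnorm_operator mulrC opnorm_comp.
Qed.

(** The adjoint of an operator into a dual space, restricted to the predual. *)
Definition preadjoint X Y (T : operator X (dual Y)) : operator Y (dual X) :=
  op_comp (adjoint T) (bidual Y).

Lemma opnorm_preadjoint X Y (T : operator X (dual Y)) :
  opnorm (preadjoint T) <= opnorm T.
Proof.
apply: le_trans (opnorm_comp _ _) _.
rewrite -[leRHS]mulr1 ler_pM ?opnorm_ge0 ?opnorm_adjoint//.
exact/opnorm_isometric/bidual_isometric.
Qed.

End Duality.

(** * Finite-dimensional spaces *)

Section FiniteDim.
Context (R : realType) (k : scalar_kind).
Local Notation K := (scalar_field R k).
Local Notation KS := (scalar_space R k).
Implicit Types X Y Z M N : completeNormedModType K.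

Lemma rank_one_sumE X Y (s : seq (dual X * Y)) x :
  op_fun (\sum_(p <- s) rank_one p.1 p.2) x
    = \sum_(p <- s) (op_fun p.1 x : K) *: p.2.
Proof. by rewrite op_sumE. Qed.

(** A continuous projection onto a finitely spanned subspace, built one
    spanning vector at a time: a functional norming the component of the new
    vector that the previous projection misses gives the next coordinate. *)
Lemma finite_span_projection X n (e : 'I_n -> X) :
  exists s : seq (dual X * X),
    (forall i, \sum_(p <- s) (op_fun p.1 (e i) : K) *: p.2 = e i) /\
    (forall x, exists c : 'I_n -> K,
       \sum_(p <- s) (op_fun p.1 x : K) *: p.2 = \sum_(i < n) c i *: e i).
Proof.
elim: n e => [|n IH] e.
  exists [::]; split=> [[]//|x]; exists (fun=> 0).
  by rewrite big_nil big_ord0.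
have [s [se sr]] := IH (fun i => e (lift ord0 i)).
pose P : operator X X := \sum_(p <- s) rank_one p.1 p.2.
have PE x : P x = \sum_(p <- s) (op_fun p.1 x : K) *: p.2 by exact: rank_one_sumE.
pose v := e ord0 - P (e ord0).
have [f _ fv] := norming_functional v.
pose a : K := (rembed k (rnorm v))^-1.
have [g gE] : exists g : dual X, forall x, op_fun g x = a * op_fun f (x - P x).
  by exists (a *: op_comp f (op_id X - P)).
exists ((g, v) :: s); split=> [i|x].
  rewrite big_cons /= gE -PE.
  have [j ->|->] := unliftP ord0 i.
    by rewrite PE se subrr linear0 mulr0 scale0r add0r.
  rewrite -/v fv; have [v0|v0] := eqVneq v 0.
    rewrite v0 scaler0 add0r; apply/eqP; rewrite eq_sym -subr_eq0 -/v.
    by rewrite v0.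
  rewrite /a mulVf ?scale1r ?subrK//.
  by apply: contra v0 => /eqP; rewrite -(rembed0 R k) => /rembed_inj/rnorm0_eq0 ->.
have [c cE] := sr x; have [d dE] := sr (e ord0).
exists (fun i => if unlift ord0 i is Some j
                 then c j - op_fun g x * d j else op_fun g x).
rewrite big_cons big_ord_recl unlift_none /= cE.
under [in RHS]eq_bigr => i _ do rewrite liftK scalerBl -scalerA.
rewrite sumrB -scaler_sumr -dE -PE /v scalerBr.
by rewrite addrAC addrA.
Qed.

Lemma finite_dim_coordinates N : finite_dim N ->
  exists s : seq (dual N * N),
    forall x, \sum_(p <- s) (op_fun p.1 x : K) *: p.2 = x.
Proof.
move=> [n [e eN]]; have [s [se _]] := finite_span_projection e.
exists s => x; have [c ->] := eN x I.
rewrite -rank_one_sumE linear_sum; apply: eq_bigr => i _.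
by rewrite linearZ /= rank_one_sumE se.
Qed.

Lemma finite_rank_decomposition X Y (T : operator X Y) : finite_rank T ->
  exists s : seq (dual X * Y), T = \sum_(p <- s) rank_one p.1 p.2.
Proof.
move=> [n [e eT]]; have [s [se _]] := finite_span_projection e.
exists [seq (op_comp p.1 T, p.2) | p <- s]; apply: opE => x.
rewrite rank_one_sumE big_map /=.
have [c cE] := eT (T x) (ex_intro2 _ _ x I erefl).
rewrite [RHS](_ : _ = (\sum_(p <- s) rank_one p.1 p.2 : operator Y Y) (T x)); last first.
  by rewrite rank_one_sumE.
rewrite cE linear_sum; apply: eq_bigr => i _.
by rewrite linearZ /= rank_one_sumE se.
Qed.

Lemma finite_rank_sum X Y (s : seq (dual X * Y)) :
  finite_rank (\sum_(p <- s) rank_one p.1 p.2).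
Proof.
exists (size s), (fun i => (nth (0, 0) s i).2) => _ [x _ <-].
exists (fun i => op_fun (nth (0, 0) s i).1 x).
by rewrite rank_one_sumE (big_nth (0, 0)) big_mkord.
Qed.

Lemma finite_dim_dual N : finite_dim N -> finite_dim (dual N).
Proof.
move=> /finite_dim_coordinates[s sE].
exists (size s), (fun i => (nth (0, 0) s i).1) => f _.
exists (fun i => op_fun f (nth (0, 0) s i).2); apply: opE => x.
rewrite -{1}(sE x) linear_sum op_sumE (big_nth (0, 0)) big_mkord.
by apply: eq_bigr => i _; rewrite linearZ; exact: mulrC.
Qed.

Lemma finite_dim_op M N (T : operator M N) : finite_dim M ->
  exists s : seq (dual M * N), T = \sum_(p <- s) rank_one p.1 p.2.
Proof.
move=> /finite_dim_coordinates[s sE].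
exists [seq (p.1, T p.2) | p <- s]; apply: opE => x.
rewrite rank_one_sumE big_map -{1}(sE x) linear_sum.
by apply: eq_bigr => p _; rewrite linearZ.
Qed.

(** With coordinate functionals [f_i] for the vectors [e_i], the inverse of the
    canonical embedding is [F |-> \sum_i F(f_i) e_i]. *)
Lemma finite_dim_reflexive N : finite_dim N ->
  exists2 T : operator (dual (dual N)) N, opnorm T <= 1 &
    forall F, bidual N (T F) = F.
Proof.
move=> /finite_dim_coordinates[s sE].
pose T : operator (dual (dual N)) N :=
  \sum_(p <- s) rank_one (eval_at p.1) p.2.
have TF F : bidual N (T F) = F.
  apply: opE => f /=; rewrite op_sumE linear_sum /=.
  have {2}-> : f = \sum_(p <- s) op_fun f p.2 *: p.1.
    apply: opE => x; rewrite -{1}(sE x) linear_sum op_sumE.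
    by apply: eq_bigr => p _; rewrite linearZ; exact: mulrC.
  by rewrite linear_sum; apply: eq_bigr => p _; rewrite !linearZ; exact: mulrC.
exists T => //; apply: opnorm_le => // F.
by rewrite mul1r -(bidual_isometric (T F)) TF.
Qed.

End FiniteDim.

(** * Finite nets and local reflexivity *)

Section Nets.
Context (R : realType).

Lemma real_net (C d : R) : 0 < d ->
  exists s : seq R, forall z, `|z| <= C -> exists2 c, c \in s & `|z - c| <= d.
Proof.
move=> d0; pose n := (Num.truncn ((C + C) / d)).+1.
exists [seq - C + d * j%:R | j <- iota 0 n] => z zC.
have [zl zr] : - C <= z /\ z <= C by move: zC; rewrite ler_norml => /andP[].
have zd : 0 <= (z + C) / d by rewrite divr_ge0 ?(ltW d0)//; lra.
have /andP[jl jr] := truncn_itv zd; set j := Num.truncn _ in jl jr.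
exists (- C + d * j%:R).
  apply/mapP; exists j => //; rewrite mem_iota /= add0n ltnS.
  apply: le_truncn; apply: ler_wpM2r; [rewrite invr_ge0 ltW//|lra].
move: jl jr; rewrite ler_pdivlMr// ltr_pdivrMr// -natr1 mulrDl mul1r.
rewrite mulrC => jl jr; rewrite ler_norml; apply/andP; split; lra.
Qed.

(** A grid on the line; for complex scalars, a product of two grids. *)
Lemma scalar_net (k : scalar_kind) (C d : R) : 0 < d ->
  exists s : seq (scalar_field R k), forall z,
    rpart `|z| <= C -> exists2 c, c \in s & rpart `|z - c| <= d.
Proof.
move=> d0; case: k => /=; first exact: real_net.
have d2 : 0 < d / 2 by lra.
have [s sP] := real_net C d2.
exists [seq (x +i* y)%C | x <- s, y <- s].
suff H (z : R[i]) : complex.Re `|z| <= C -> exists2 c,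
    c \in [seq (x +i* y)%C | x <- s, y <- s] & complex.Re `|z - c| <= d.
  exact: H.
case: z => x y; rewrite normc_def /= => zC.
have [a as_ ax] : exists2 c, c \in s & `|x - c| <= d / 2.
  apply: sP; apply: le_trans zC.
  by rewrite -[`|x|]sqrtr_sqr ler_wsqrtr// lerDl sqr_ge0.
have [b bs by_] : exists2 c, c \in s & `|y - c| <= d / 2.
  apply: sP; apply: le_trans zC.
  by rewrite -[`|y|]sqrtr_sqr ler_wsqrtr// lerDr sqr_ge0.
exists (a +i* b)%C; first by apply/allpairsP; exists (a, b).
rewrite /= (@le_trans _ _ (`|x - a| + `|y - b|))//; last lra.
rewrite -[leRHS]ger0_norm ?addr_ge0// -[leRHS]sqrtr_sqr ler_wsqrtr//.
rewrite [leRHS]sqrrD !real_normK ?num_real//.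
by rewrite addrAC lerDl mulrn_wge0// mulr_ge0.
Qed.

End Nets.

Section LocalReflexivity.
Context (R : realType) (k : scalar_kind).
Local Notation K := (scalar_field R k).
Local Notation KS := (scalar_space R k).
Implicit Types X Y Z M N : completeNormedModType K.

(** Coordinates range in discs, so products of grids of scalars form a net for
    the unit ball. *)
Lemma coordinate_net N (s : seq (dual N * N)) (e : R) : 0 < e ->
  exists P : seq N, forall x, rnorm x <= 1 ->
    exists2 p, p \in P &
      rnorm (\sum_(q <- s) (op_fun q.1 x : K) *: q.2 - p) <= e.
Proof.
elim: s e => [|[f v] s IH] e e0.
  exists [:: 0] => x _; exists 0; first by rewrite inE.
  by rewrite big_nil subr0 rnorm0 ltW.
have e2 : 0 < e / 2 by lra.
have v1 : 0 < rnorm v + 1 by rewrite ltr_wpDl ?rnorm_ge0.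
have [P PP] := IH _ e2.
have [G GP] := @scalar_net R k (opnorm f) _ (divr_gt0 e2 v1).
exists [seq c *: v + p | c <- G, p <- P] => x x1.
have [p pP px] := PP x x1.
have [c cG cx] : exists2 c, c \in G &
    rpart `|op_fun f x - c| <= e / 2 / (rnorm v + 1).
  apply: GP; rewrite (le_trans (opnormP f x))// ler_piMr ?opnorm_ge0//.
exists (c *: v + p); first by apply/allpairsP; exists (c, p).
rewrite big_cons /= opprD addrACA -scalerBl (le_trans (rnormD _ _))//.
rewrite rnormZ [e]splitr lerD//.
rewrite (le_trans (ler_wpM2r (rnorm_ge0 v) cx))//.
by rewrite mulrAC ler_pdivrMr// ler_wpM2l ?(ltW e2)// lerDl.
Qed.

Lemma finite_dim_net N (e : R) : finite_dim N -> 0 < e ->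
  exists P : seq N, (forall p, p \in P -> rnorm p <= 1 + e) /\
    forall x, rnorm x <= 1 -> exists2 p, p \in P & rnorm (x - p) <= e.
Proof.
move=> /finite_dim_coordinates[s sE] /(coordinate_net s)[P PP].
exists [seq p <- P | rnorm p <= 1 + e]; split=> [p|x x1].
  by rewrite mem_filter => /andP[].
have [p pP] := PP x x1; rewrite sE => px; exists p => //.
rewrite mem_filter pP andbT -[p](subKr x) (le_trans (rnormD _ _))//.
by rewrite rnormN lerD.
Qed.

Lemma opnorm_le_ball X Y (T : operator X Y) (C : R) :
  (forall x, rnorm x <= 1 -> rnorm (T x) <= C) -> opnorm T <= C.
Proof.
move=> TC; apply: ge_sup; first exact: (opnorm_has_sup T).1.
by move=> _ [x /= x1 <-]; exact: TC.
Qed.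

Lemma opnorm_approx X Y (T : operator X Y) (e : R) : 0 < e ->
  exists2 x, rnorm x <= 1 & opnorm T <= rnorm (T x) + e.
Proof.
move=> e0; have [_ [x x1 <-] xe] := sup_adherent e0 (opnorm_has_sup T).
by exists x => //; rewrite -lerBlDr ltW.
Qed.

Definition tuple_norm X n (z : 'I_n -> X) : R :=
  \big[Num.max/0]_(i < n) rnorm (z i).

Lemma tuple_norm_ge0 X n (z : 'I_n -> X) : 0 <= tuple_norm z.
Proof. exact: bigmax_ge_id. Qed.

Lemma tuple_norm_ge X n (z : 'I_n -> X) i : rnorm (z i) <= tuple_norm z.
Proof. exact: (le_bigmax _ (fun i => rnorm (z i))). Qed.

Lemma tuple_norm_le X n (z : 'I_n -> X) c : 0 <= c ->
  (forall i, rnorm (z i) <= c) -> tuple_norm z <= c.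
Proof. by move=> c0 zc; apply: bigmax_le. Qed.

Lemma tuple_norm_seminorm X n (c : R) : 0 <= c ->
  seminorm (fun z : 'I_n -> X => c * tuple_norm z).
Proof.
move=> c0; apply: seminorm_of_le => [x y|a x].
  rewrite -mulrDr ler_wpM2l// tuple_norm_le ?addr_ge0 ?tuple_norm_ge0// => i.
  by rewrite (le_trans (rnormD _ _))// lerD ?tuple_norm_ge.
rewrite mulrCA ler_wpM2l// tuple_norm_le ?mulr_ge0 ?tuple_norm_ge0//.
  exact: rpart_norm_ge0.
by move=> i; rewrite rnormZ ler_wpM2l ?tuple_norm_ge ?rpart_norm_ge0.
Qed.

(** The dual of the maximum norm is the sum of the dual norms: near-norming
    vectors of the components, rotated to give positive values, form a tuple at
    which the values add up. *)
Lemma tuple_functional X n (psi : ('I_n -> X) -> KS) (C : R) :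
  linear psi -> 0 <= C ->
  (forall z, rpart `|psi z : K| <= C * tuple_norm z) ->
  exists2 g : 'I_n -> dual X, (forall z, psi z = \sum_(i < n) op_fun (g i) (z i)) &
    \sum_(i < n) opnorm (g i) <= C.
Proof.
move=> psil C0 psiC.
pose PP : {linear ('I_n -> X) -> KS} :=
  HB.pack psi (GRing.isLinear.Build K ('I_n -> X) KS *:%R psi psil).
pose one i (x : X) : 'I_n -> X := fun j => if j == i then x else 0.
have gP i : exists g : dual X, forall x, op_fun g x = psi (one i x).
  have [||g gE _] := @op_of_bound R k X KS (fun x => psi (one i x)) C _ C0.
  - move=> a x y; rewrite -psil; congr psi; apply/funext => j.
    by rewrite /one !fctE; case: ifP => // _; rewrite scaler0 addr0.
  - move=> x; rewrite (le_trans (psiC _))// ler_wpM2l//.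
    apply: tuple_norm_le; first exact: rnorm_ge0.
    by move=> j; rewrite /one; case: ifP; rewrite ?rnorm0 ?rnorm_ge0.
  - by exists g.
have [g gE] := choice gP.
have psiE z : psi z = \sum_(i < n) op_fun (g i) (z i).
  under eq_bigr => i _ do rewrite gE.
  rewrite -[RHS](linear_sum PP); congr psi; apply/funext => j.
  rewrite fct_sumE (bigD1 j)//= /one eqxx big1 ?addr0// => i ij.
  by rewrite eq_sym (negbTE ij).
exists g => //; apply/ler_addgt0Pr => e e0.
have en : 0 < e / n.+1%:R by rewrite divr_gt0.
have /choice[x xP] i : exists x : X,
    rnorm x <= 1 /\ opnorm (g i) <= rnorm (op_fun (g i) x) + e / n.+1%:R.
  by have [x] := opnorm_approx (g i) en; exists x.
have /choice[a aP] i : exists a : K,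
    rpart `|a| = 1 /\ a * (op_fun (g i) (x i) : K) = `|op_fun (g i) (x i) : K|.
  by have [a] := scalar_phase (op_fun (g i) (x i) : K); exists a.
have : rpart (psi (fun i => a i *: x i)) <= C.
  rewrite (le_trans (rpart_le_norm _))// (le_trans (psiC _))//.
  rewrite ler_piMr//; apply: tuple_norm_le => // i.
  by rewrite rnormZ (aP i).1 mul1r (xP i).1.
rewrite psiE.
have -> : rpart (\sum_(i < n) op_fun (g i) (a i *: x i)) =
    \sum_(i < n) rnorm (op_fun (g i) (x i)).
  rewrite (big_morph (@rpart R k) (@rpartD R k) (@rpart0 R k)).
  by apply: eq_bigr => i _; rewrite linearZ -[LHS]/(rpart (a i * _)) (aP i).2.
rewrite -(lerD2r e); apply: le_trans.
rewrite (le_trans (ler_sum _ (fun i _ => (xP i).2)))// big_split/= lerD2l.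
rewrite sumr_const card_ord -[leLHS]mulr_natr -mulrA ler_piMr ?(ltW e0)//.
by rewrite mulrC ler_pdivrMr// mul1r ler_nat.
Qed.

(** The principle of local reflexivity in dual form: on finitely many
    evaluations an operator into the bidual is no larger than the operators
    into the space itself.  The operators from [N] to [X] embed into tuples of
    vectors by evaluation on a net of the unit ball of [N]; a Hahn-Banach
    extension to all tuples is a finite sum of evaluations on the net, and such
    a sum represents the same tensor in [N (x) X^*], so it can be evaluated at
    operators into the bidual as well. *)
Theorem local_reflexivity N X (J : operator N (dual (dual X)))
    (s : seq (N * dual X)) (C : R) :
  finite_dim N -> 0 <= C ->
  (forall T : operator N X,
     rnorm (\sum_(p <- s) op_fun p.2 (T p.1) : KS) <= C * opnorm T) ->
  rnorm (\sum_(p <- s) op_fun (op_fun J p.1) p.2 : KS) <= C * opnorm J.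
Proof.
move=> Nfin C0 sC; set V := rnorm _.
suff H e : 0 < e -> e < 1 -> (1 - e) * V <= (1 + e) * (C * opnorm J).
  apply/ler_addgt0Pr => d d0; set B := C * _ in H *.
  have B0 : 0 <= B by rewrite mulr_ge0 ?opnorm_ge0.
  have V0 : 0 <= V by exact: rnorm_ge0.
  have den : 0 < d + V + B + 1 by lra.
  pose e := d / (d + V + B + 1).
  have e0 : 0 < e by rewrite divr_gt0.
  have e1 : e < 1 by rewrite ltr_pdivrMr//; lra.
  have eE : e * (d + V + B + 1) = d by rewrite divfK// gt_eqF.
  have := H e e0 e1; have := mulr_gt0 e0 d0; nra.
move=> e0 e1.
have [P [Pe Pnet]] := finite_dim_net Nfin e0.
(* Evaluation on an [e]-net of the ball recovers operator norms up to [1 - e]. *)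
pose n := size P.
pose L (T : operator N X) : 'I_n -> X := fun i => T P`_i.
pose Phi (T : operator N X) : KS := \sum_(p <- s) op_fun p.2 (T p.1).
pose c := C / (1 - e).
have e1' : 0 < 1 - e by lra.
have c0 : 0 <= c by rewrite divr_ge0// ltW.
have TL T : opnorm T <= (1 - e)^-1 * tuple_norm (L T).
  rewrite mulrC ler_pdivlMr// mulrBr mulr1 lerBlDr.
  apply: opnorm_le_ball => x x1; have [p pP px] := Pnet x x1.
  rewrite -[x](subrK p) linearD (le_trans (rnormD _ _))// addrC lerD//.
    move: pP => /(nthP 0)[i iP <-].
    exact: (tuple_norm_ge (L T) (Ordinal iP)).
  by rewrite (le_trans (opnormP _ _))// ler_wpM2l ?opnorm_ge0.
have [||T|psi [psil psiL psic]] :=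
    hahn_banach (U := operator N X) (L := L) (Phi := Phi)
      (tuple_norm_seminorm X n c0).
- by move=> a S T.
- move=> a S T; rewrite /Phi scaler_sumr -big_split; apply: eq_bigr => p _.
  by rewrite /= linearP.
- rewrite (le_trans (sC T))// /c -mulrA ler_wpM2l//.
have [g psig gc] := tuple_functional psil c0 psic.
(* Rank one operators show that both sums are the same tensor of [N (x) X^*]. *)
have key (h : dual N) : \sum_(p <- s) (op_fun h p.1 : K) *: p.2
    = \sum_(i < n) (op_fun h P`_i : K) *: g i.
  apply: opE => x; have := psiL (rank_one h x); rewrite psig /L /Phi !op_sumE.
  under eq_bigr => i _ do rewrite linearZ.
  under [in RHS]eq_bigr => i _ do rewrite linearZ.
  by move=> ->.
have [t tE] := finite_dim_coordinates Nfin.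
have JE (q : N) (f : dual X) : op_fun (op_fun J q) f =
    \sum_(r <- t) op_fun (op_fun J r.2) ((op_fun r.1 q : K) *: f).
  rewrite -{1}(tE q) linear_sum op_sumE; apply: eq_bigr => r _.
  by rewrite !linearZ.
have VE : \sum_(p <- s) op_fun (op_fun J p.1) p.2 =
    \sum_(i < n) op_fun (op_fun J P`_i) (g i).
  under eq_bigr => p _ do rewrite JE.
  under [in RHS]eq_bigr => i _ do rewrite JE.
  rewrite exchange_big [RHS]exchange_big; apply: eq_bigr => r _.
  by rewrite -!linear_sum key.
have Vle : V <= \sum_(i < n) (1 + e) * opnorm J * opnorm (g i).
  rewrite /V VE; elim/big_ind2: _ => [|x y u v xy uv|i _].
  - by rewrite rnorm0.
  - by rewrite (le_trans (rnormD _ _))// lerD.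
  - rewrite (le_trans (opnormP _ _))// rnorm_operator ler_wpM2r ?opnorm_ge0//.
    rewrite -rnorm_operator (le_trans (opnormP _ _))// mulrC.
    by rewrite ler_wpM2r ?opnorm_ge0// Pe// mem_nth.
rewrite -mulr_sumr in Vle.
rewrite -ler_pdivlMl// (le_trans Vle)//.
rewrite (le_trans (ler_wpM2l _ gc))//.
  by rewrite mulr_ge0 ?opnorm_ge0//; lra.
by rewrite le_eqVlt; apply/orP; left; apply/eqP; rewrite /c; ring.
Qed.

End LocalReflexivity.

(** * Finite-dimensional subspaces *)

Section FixedSpace.
Context (R : realType) (k : scalar_kind).
Local Notation K := (scalar_field R k).
Context (X : completeNormedModType K) (P : operator X X).

(** The range of a continuous projection, as a closed subspace. *)
Definition fixed_vectors : {pred X} := fun x => P x == x.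

Lemma fixed_vectors_submod : submod_closed fixed_vectors.
Proof.
split; first by rewrite unfold_in linear0.
move=> a x y /eqP Px /eqP Py; rewrite unfold_in /fixed_vectors linearP.
by rewrite /= Px Py.
Qed.

HB.instance Definition _ := GRing.isSubmodClosed.Build K X
  fixed_vectors fixed_vectors_submod.

Record fixed_space := FixedVector {
  fixed_val :> X;
  fixed_valP : fixed_val \in fixed_vectors }.

HB.instance Definition _ := [isSub for fixed_val].
HB.instance Definition _ := [Choice of fixed_space by <:].
HB.instance Definition _ := [SubChoice_isSubLmodule of fixed_space by <:].

Let fnorm (x : fixed_space) : K := `|fixed_val x|.

Let fnormD (x y : fixed_space) : fnorm (x + y) <= fnorm x + fnorm y.
Proof. exact: ler_normD. Qed.

Let fnormZ (a : K) (x : fixed_space) : fnorm (a *: x) = `|a| * fnorm x.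
Proof. exact: normrZ. Qed.

Let fnorm0_eq0 (x : fixed_space) : fnorm x = 0 -> x = 0.
Proof. by move=> /normr0_eq0 x0; apply/val_inj. Qed.

HB.instance Definition _ :=
  Lmodule_isNormed.Build K fixed_space fnormD fnormZ fnorm0_eq0.

Lemma fixed_space_complete (F : set_system fixed_space) :
  ProperFilter F -> cauchy F -> cvg F.
Proof.
move=> FF cF.
have : cvg (fixed_val @ F).
  apply: cauchy_cvg; apply/cauchy_ballP => e e0.
  move/cauchy_ballP : cF => /(_ e e0)[[A B]/= [FA FB] AB].
  exists (fixed_val @` A, fixed_val @` B) => /=.
    by split; exact: (filterS (@preimage_image _ _ fixed_val _)).
  move=> [_ _] [/= [x Ax <-] [y By <-]].
  by have := AB (x, y) (conj Ax By); rewrite -!ball_normE.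
move=> /cvg_ex[x Fx].
have Px : P x = x.
  apply: (@cvg_unique _ (@norm_hausdorff _ X) (fixed_val @ F)) => //.
  have : (fun y : fixed_space => P (fixed_val y)) @ F --> P x.
    by apply: (@continuous_cvg _ _ _ F FF fixed_val P x) => //; exact: op_continuous.
  apply: cvg_trans; apply: near_eq_cvg; near=> y.
  by have := fixed_valP y; rewrite unfold_in => /eqP.
have xP : x \in fixed_vectors by rewrite unfold_in Px.
apply/cvg_ex; exists (FixedVector xP); apply/cvgrPdist_le => e e0.
by move/cvgrPdist_le : Fx => /(_ e e0).
Unshelve. all: by end_near. Qed.

HB.instance Definition _ :=
  Uniform_isComplete.Build fixed_space fixed_space_complete.

End FixedSpace.

Section RangeFactorization.
Context (R : realType) (k : scalar_kind).
Local Notation K := (scalar_field R k).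
Local Notation banach := (completeNormedModType K).

Lemma finite_span_subspace (Y : banach) n (e : 'I_n -> Y) :
  exists (E : banach) (i : operator E Y),
    [/\ finite_dim E, isometric_embedding i &
        forall c : 'I_n -> K, exists z, i z = \sum_(j < n) c j *: e j].
Proof.
have [s [se sr]] := finite_span_projection e.
pose P : operator Y Y := \sum_(p <- s) rank_one p.1 p.2.
have PE y : P y = \sum_(p <- s) (op_fun p.1 y : K) *: p.2 by exact: rank_one_sumE.
have eP j : e j \in fixed_vectors P.
  by rewrite unfold_in /fixed_vectors PE se.
pose E : banach := fixed_space P.
have il : linear (fun x : E => fixed_val x) by [].
have iC (x : E) : rnorm (fixed_val x) <= 1 * rnorm x by rewrite mul1r.
have [i iE _] := op_of_bound il ler01 iC.
pose e' j : E := FixedVector (eP j).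
exists E, i; split.
- exists n, e' => y _.
  have [c cE] := sr (fixed_val y); exists c; apply/val_inj.
  have /eqP := fixed_valP y; rewrite PE cE => yE.
  rewrite -[LHS]/(fixed_val y) -yE raddf_sum.
  by apply: eq_bigr.
- by move=> x; rewrite iE.
- move=> c; exists (\sum_(j < n) c j *: e' j); rewrite linear_sum.
  by apply: eq_bigr => j _; rewrite linearZ /= iE.
Qed.

(** Tensor norms are generated from subspaces, so an operator that is not
    isometric has to be pushed through its range. *)
Lemma range_factorization (M Y : banach) (T : operator M Y) : finite_dim M ->
  exists (E : banach) (i : operator E Y) (S : operator M E),
    [/\ finite_dim E, isometric_embedding i, op_comp i S = T &
        opnorm S <= opnorm T].
Proof.
move=> [n [e eM]].
have [E [i [Efin ii iP]]] := finite_span_subspace (fun j => T (e j)).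
have /choice[S iS] x : exists z, i z = T x.
  have [c ->] := eM x I; have [z zE] := iP c; exists z.
  by rewrite zE linear_sum; apply: eq_bigr => j _; rewrite linearZ.
have iinj x y : i x = i y -> x = y.
  move=> xy; apply/eqP; rewrite -subr_eq0; apply/eqP/(@rnorm0_eq0 R k E).
  by rewrite -ii linearB /= xy subrr rnorm0.
have Sl : linear S by move=> a x y; apply: iinj; rewrite linearP /= !iS linearP.
have SC x : rnorm (S x) <= opnorm T * rnorm x by rewrite -ii iS opnormP.
have [S' SE S'T] := op_of_bound Sl (opnorm_ge0 T) SC.
exists E, i, S'; split=> //.
by apply: opE => x /=; rewrite SE iS.
Qed.

End RangeFactorization.

(** * Tensors *)

Section TensorCalculus.
Context (R : realType) (k : scalar_kind).
Local Notation K := (scalar_field R k).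
Local Notation KS := (scalar_space R k).
Local Notation form X Y := {bilinear X -> Y -> KS}.

Section Algebraic.
Context (X Y : lmodType K).
Implicit Types u v : tensor X Y.

Lemma tensorP u v : (forall B, u B = v B) -> u = v.
Proof. by move=> uv; apply/val_inj/funext. Qed.

Lemma tensor_sumE I (s : seq I) (F : I -> tensor X Y) (B : form X Y) :
  tensor_fun (\sum_(i <- s) F i) B = \sum_(i <- s) tensor_fun (F i) B.
Proof. by elim/big_rec2: _ => //= i y T _ <-. Qed.

Lemma tensor_decomposition u :
  exists s : seq (X * Y), u = \sum_(p <- s) tens p.1 p.2.
Proof.
have [s us] := tensorE u; exists s; apply: tensorP => B.
by rewrite us tensor_sumE.
Qed.

Lemma tensor_form_ext u (B B' : form X Y) :
  (forall x y, B x y = B' x y) -> u B = u B'.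
Proof.
move=> BB'; have [s us] := tensorE u.
by rewrite !us; apply: eq_bigr => p _; exact: BB'.
Qed.

End Algebraic.

(** The entries are typed by the Banach spaces and not by the underlying modules,
    which lets these sequences meet sequences of functionals and vectors without
    a comparison of the two structures. *)
Lemma banach_tensor_decomposition (X Y : completeNormedModType K)
    (u : tensor X Y) :
  exists s : seq (X * Y), u = \sum_(p <- s) tens p.1 p.2.
Proof. exact: tensor_decomposition. Qed.

Lemma tensor_swap_sum (X Y : lmodType K) (s : seq (X * Y)) :
  tensor_swap (\sum_(p <- s) tens p.1 p.2) = \sum_(p <- s) tens p.2 p.1.
Proof. by apply: tensorP => B; rewrite /= !tensor_sumE. Qed.

Lemma tensor_map_sum (X Y X' Y' : completeNormedModType K)
    (S : operator X X') (T : operator Y Y') (s : seq (X * Y)) :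
  tensor_map S T (\sum_(p <- s) tens p.1 p.2)
    = \sum_(p <- s) tens (S p.1) (T p.2).
Proof. by apply: tensorP => B; rewrite /= !tensor_sumE. Qed.

Lemma tensor_map_comp (X Y X' Y' X'' Y'' : completeNormedModType K)
    (S : operator X X') (T : operator Y Y')
    (S' : operator X' X'') (T' : operator Y' Y'') (u : tensor X Y) :
  tensor_map S' T' (tensor_map S T u)
    = tensor_map (op_comp S' S) (op_comp T' T) u.
Proof. by apply: tensorP => B /=; apply: tensor_form_ext. Qed.

Lemma tensor_map_id (X Y : completeNormedModType K) (u : tensor X Y) :
  tensor_map (op_id X) (op_id Y) u = u.
Proof. by apply: tensorP => B /=; apply: tensor_form_ext. Qed.

Lemma tensor_mapZ (X Y X' Y' : completeNormedModType K)
    (S : operator X X') (T : operator Y Y') (a : K) (u : tensor X Y) :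
  tensor_map S T (a *: u) = a *: tensor_map S T u.
Proof. by apply: tensorP. Qed.

Lemma pairing_swap (X X' Y Y' : lmodType K) (b : form X X') (c : form Y Y')
    (b' : form X' X) (c' : form Y' Y) (u : tensor X Y) (v : tensor X' Y') :
  (forall x x', b x x' = b' x' x) -> (forall y y', c y y' = c' y' y) ->
  pairing b c u v = pairing b' c' v u.
Proof.
move=> bb' cc'; have [s ->] := tensor_decomposition u.
have [t ->] := tensor_decomposition v.
rewrite /pairing !tensor_sumE.
under eq_bigr => p _ do rewrite /= /pairing_form tensor_sumE.
under [RHS]eq_bigr => p _ do rewrite /= /pairing_form tensor_sumE.
rewrite exchange_big; apply: eq_bigr => q _; apply: eq_bigr => p _.
by rewrite /= /form_prod bb' cc'.
Qed.

Lemma pairing_map (X Y Z W X' Y' Z' W' : completeNormedModType K)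
    (b : form Z X') (c : form W Y') (b' : form X Z') (c' : form Y W')
    (S : operator X Z) (T : operator Y W)
    (S' : operator X' Z') (T' : operator Y' W')
    (u : tensor X Y) (v : tensor X' Y') :
  (forall x x', b (S x) x' = b' x (S' x')) ->
  (forall y y', c (T y) y' = c' y (T' y')) ->
  pairing b c (tensor_map S T u) v = pairing b' c' u (tensor_map S' T' v).
Proof.
move=> bS cT; rewrite /pairing /=; apply: tensor_form_ext => x y /=.
rewrite /form_comp /= /pairing_form /=; apply: tensor_form_ext => x' y' /=.
by rewrite /form_comp /= /form_prod bS cT.
Qed.

Lemma pairing_coevC (X Y : completeNormedModType K)
    (u : tensor X Y) (v : tensor (dual X) (dual Y)) :
  pairing (@coev R k X) (@coev R k Y) u v = pairing (@ev R k X) (@ev R k Y) v u.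
Proof. exact: pairing_swap. Qed.

Lemma pairing_evC (X Y : completeNormedModType K)
    (u : tensor (dual X) Y) (v : tensor X (dual Y)) :
  pairing (@ev R k X) (@coev R k Y) u v = pairing (@coev R k X) (@ev R k Y) v u.
Proof. exact: pairing_swap. Qed.

Lemma pairingZr (X X' Y Y' : lmodType K) (b : form X X') (c : form Y Y')
    (u : tensor X Y) (a : K) (v : tensor X' Y') :
  pairing b c u (a *: v) = a *: pairing b c u v.
Proof.
have [s us] := tensorE u; rewrite /pairing !us /tensor_eval scaler_sumr.
exact: eq_bigr.
Qed.

Lemma pairingZl (X X' Y Y' : lmodType K) (b : form X X') (c : form Y Y')
    (u : tensor X Y) (a : K) (v : tensor X' Y') :
  pairing b c (a *: u) v = a *: pairing b c u v.
Proof. by []. Qed.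

End TensorCalculus.

(** * Functional norms, finite hulls and dual tensor norms *)

Section FunctionalNorms.
Context (R : realType) (k : scalar_kind).
Local Notation K := (scalar_field R k).
Local Notation KS := (scalar_space R k).

Lemma functional_norm_le (V : Type) (p : V -> R) (f : V -> KS) (C : R) :
  (forall v, p v <= 1 -> rnorm (f v) <= C) ->
  (functional_norm p f <= C%:E)%E.
Proof.
by move=> fC; apply: ge_ereal_sup => _ [v /= v1 <-]; rewrite lee_fin fC.
Qed.

Lemma functional_norm_bound (V : lmodType K) (p : V -> R) (f : V -> KS)
    (C : R) (v : V) : 0 <= C -> 0 <= p v ->
  (forall a v, p (a *: v) <= rpart `|a| * p v) ->
  (forall a v, f (a *: v) = a *: f v) ->
  (functional_norm p f <= C%:E)%E -> rnorm (f v) <= C * p v.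
Proof.
move=> C0 pv0 pZ fZ fC.
have H r : 0 < r -> p v <= r -> rnorm (f v) <= C * r.
  move=> r0 vr; have ri : 0 <= r^-1 by rewrite invr_ge0 ltW.
  rewrite -ler_pdivrMr// mulrC -[r^-1](rpart_norm_rembed k ri) -rnormZ -fZ.
  rewrite -lee_fin; apply: le_trans fC; apply: ereal_sup_ubound.
  exists (rembed k r^-1 *: v) => //=.
  rewrite (le_trans (pZ _ _))// rpart_norm_rembed// mulrC.
  by rewrite ler_pdivrMr// mul1r.
apply/ler_addgt0Pr => e e0.
have C1 : 0 < C + 1 by lra.
have eC : 0 < e / (C + 1) by rewrite divr_gt0.
have := H (p v + e / (C + 1)); rewrite ltr_wpDl// lerDl ltW// => /(_ isT isT).
move=> /le_trans; apply; rewrite mulrDr lerD2l.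
by rewrite mulrCA ler_piMr ?(ltW e0)// ler_pdivrMr//; lra.
Qed.

End FunctionalNorms.

Section DualTensorNorms.
Context (R : realType) (k : scalar_kind).
Local Notation K := (scalar_field R k).
Local Notation KS := (scalar_space R k).
Local Notation banach := (completeNormedModType K).
Local Notation duality w z := (pairing (@coev R k _) (@coev R k _) w z).
Implicit Types beta : tensor_family R k.

(** The crossnorm axioms on which trace duality rests; they pass from a crossnorm
    to its dual norm ([tensor_dual_like]), so that duality can be iterated. *)
Record crossnorm_like beta : Prop := {
  cross_ge0 : forall (X Y : banach) (u : tensor X Y), 0 <= beta X Y u;
  crossZ : forall (X Y : banach) (a : K) (u : tensor X Y),
    beta X Y (a *: u) <= rpart `|a| * beta X Y u;
  cross_dual : forall (X Y : banach) (f : dual X) (g : dual Y) (u : tensor X Y),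
    rnorm (u (form_prod (op_fun f) (op_fun g)))
      <= opnorm f * opnorm g * beta X Y u }.

Lemma uniform_crossnorm_like alpha :
  uniform_crossnorm alpha -> crossnorm_like alpha.
Proof.
move=> a; split=> [X Y u|X Y c u|]; last exact: crossnorm_dual a.
  suff /seminorm_ge0 : seminorm (alpha X Y) by apply.
  by split; [exact: (crossnormD a)|exact: (crossnormZ a)].
by rewrite (crossnormZ a).
Qed.

Lemma cross0 beta (X Y : banach) : crossnorm_like beta ->
  beta X Y 0 = 0.
Proof.
move=> b; apply/eqP; rewrite eq_le cross_ge0// andbT.
by have := crossZ b 0 (0 : tensor X Y); rewrite scale0r rpart_norm0 mul0r.
Qed.

(** The functional norm is a supremum in the extended reals, of which the dual
    norm is the finite part; a bound on the unit ball makes the two agree. *)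
Lemma dual_norm_fin_bounds beta (M N : banach) (w : tensor M N) (C : R) :
  crossnorm_like beta -> 0 <= C ->
  (forall z, beta (dual M) (dual N) z <= 1 -> rnorm (duality w z) <= C) ->
  [/\ 0 <= dual_norm_fin beta w, dual_norm_fin beta w <= C &
      functional_norm (beta (dual M) (dual N))
        (pairing (@coev R k M) (@coev R k N) w) = (dual_norm_fin beta w)%:E].
Proof.
move=> b C0 wC; have le := functional_norm_le wC.
have ge : (0%:E <= functional_norm (beta (dual M) (dual N))
    (pairing (@coev R k M) (@coev R k N) w))%E.
  apply: le_trans (ereal_sup_ubound _); last first.
    by exists 0 => //=; rewrite cross0.
  by rewrite lee_fin rnorm_ge0.
by rewrite /dual_norm_fin; case: (functional_norm _ _) le ge => [r||].
Qed.

(** A representation of [w] bounds its functional, whatever [beta] is: the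
    elementary tensors act as product functionals. *)
Lemma pairing_bounded beta (M N : banach) (w : tensor M N) :
  crossnorm_like beta ->
  exists2 C, 0 <= C & forall z, rnorm (duality w z) <= C * beta (dual M) (dual N) z.
Proof.
move=> b; have [s ->] := banach_tensor_decomposition w.
exists (\sum_(p <- s) rnorm p.1 * rnorm p.2) => [|z].
  by apply: sumr_ge0 => p _; rewrite mulr_ge0 ?rnorm_ge0.
rewrite /pairing tensor_sumE mulr_suml.
elim/big_ind2: _ => [|x y u v xy uv|p _].
- by rewrite rnorm0.
- by rewrite (le_trans (rnormD _ _))// lerD.
- have := cross_dual b (eval_at p.1) (eval_at p.2) z.
  rewrite -!rnorm_operator !eval_at_norm; apply: le_trans.
  rewrite le_eqVlt; apply/orP; left; apply/eqP; congr rnorm.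
  by rewrite /= /pairing_form; apply: tensor_form_ext.
Qed.

Lemma dual_norm_fin_ge0 beta (M N : banach) (w : tensor M N) :
  crossnorm_like beta -> 0 <= dual_norm_fin beta w.
Proof.
move=> b; have [C C0 wC] := pairing_bounded w b.
have [z z1|//] := @dual_norm_fin_bounds beta M N w C b C0.
by rewrite (le_trans (wC z))// ler_piMr.
Qed.

Lemma dual_norm_fin_le beta (M N : banach) (w : tensor M N) (C : R) :
  crossnorm_like beta -> 0 <= C ->
  (forall z, rnorm (duality w z) <= C * beta (dual M) (dual N) z) ->
  dual_norm_fin beta w <= C.
Proof.
move=> b C0 wC; have [z z1|//] := @dual_norm_fin_bounds beta M N w C b C0.
by rewrite (le_trans (wC z))// ler_piMr.
Qed.

Lemma dual_norm_finP beta (M N : banach) (w : tensor M N)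
    (z : tensor (dual M) (dual N)) : crossnorm_like beta ->
  rnorm (duality w z) <= dual_norm_fin beta w * beta (dual M) (dual N) z.
Proof.
move=> b; have [C C0 wC] := pairing_bounded w b.
have [|d0 _ dE] := @dual_norm_fin_bounds beta M N w C b C0.
  by move=> y y1; rewrite (le_trans (wC y))// ler_piMr.
apply: (functional_norm_bound d0) => [|a v|a v|].
- exact: cross_ge0.
- exact: crossZ.
- exact: pairingZr.
- by rewrite dE.
Qed.

(** Every tensor lives on finite-dimensional subspaces, so the infimum that
    defines a finite hull is over a nonempty set. *)
Lemma finite_tensor (X Y : banach) (u : tensor X Y) :
  exists (M N : banach) (I : operator M X) (J : operator N Y) (w : tensor M N),
    [/\ finite_dim M, finite_dim N,
        isometric_embedding I & isometric_embedding J] /\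
    tensor_map I J w = u.
Proof.
have [s ->] := banach_tensor_decomposition u.
pose n := size s; pose x i := (nth (0, 0) s i).1; pose y i := (nth (0, 0) s i).2.
have [M [I [Mfin Ii IP]]] := finite_span_subspace (fun i : 'I_n => x i).
have [N [J [Nfin Ji JP]]] := finite_span_subspace (fun i : 'I_n => y i).
have delta (V : lmodType K) (e : 'I_n -> V) i :
    \sum_(j < n) ((j == i)%:R : K) *: e j = e i.
  rewrite (bigD1 i)//= eqxx scale1r big1 ?addr0// => j /negbTE ->.
  by rewrite scale0r.
have /choice[m mE] (i : 'I_n) : exists z, I z = x (nat_of_ord i).
  by have [z zE] := IP (fun j => (j == i)%:R); exists z; rewrite zE delta.
have /choice[l lE] (i : 'I_n) : exists z, J z = y (nat_of_ord i).
  by have [z zE] := JP (fun j => (j == i)%:R); exists z; rewrite zE delta.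
exists M, N, I, J, (\sum_(p <- [seq (m i, l i) | i <- enum 'I_n]) tens p.1 p.2).
split=> //; rewrite tensor_map_sum big_map big_enum (big_nth (0, 0)) big_mkord.
by apply: eq_bigr => i _; rewrite /= mE lE.
Qed.

Section FiniteHull.
Context (g : tensor_family R k).
Hypothesis g_ge0 : forall (M N : banach) (w : tensor M N), 0 <= g w.

Lemma finite_hull_ge0 (X Y : banach) (u : tensor X Y) : 0 <= finite_hull g u.
Proof.
have [M [N [I [J [w [fin wu]]]]]] := finite_tensor u.
apply: lb_le_inf; first by exists (g w), M, N, I, J, w.
by move=> _ [M' [N' [I' [J' [w' [_ [_ ->]]]]]]].
Qed.

Lemma finite_hull_le (X Y M N : banach) (I : operator M X) (J : operator N Y)
    (w : tensor M N) : finite_dim M -> finite_dim N ->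
  isometric_embedding I -> isometric_embedding J ->
  finite_hull g (tensor_map I J w) <= g w.
Proof.
move=> Mf Nf Ii Ji; apply: ge_inf; last by exists M, N, I, J, w.
by exists 0 => _ [M' [N' [I' [J' [w' [_ [_ ->]]]]]]].
Qed.

Lemma finite_hull_approx (X Y : banach) (u : tensor X Y) (e : R) : 0 < e ->
  exists (M N : banach) (I : operator M X) (J : operator N Y) (w : tensor M N),
    [/\ finite_dim M, finite_dim N,
        isometric_embedding I & isometric_embedding J] /\
    (tensor_map I J w = u /\ g w <= finite_hull g u + e).
Proof.
move=> e0; have [M [N [I [J [w [fin wu]]]]]] := finite_tensor u.
have [|_ [M' [N' [I' [J' [w' [fin' [w'u ->]]]]]]] gw'] :=
    @inf_adherent _ [set r | exists (M N : banach)
                 (I : operator M X) (J : operator N Y) (w : tensor M N),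
         [/\ finite_dim M, finite_dim N,
             isometric_embedding I & isometric_embedding J] /\
         (tensor_map I J w = u /\ r = g w)] e e0.
  split; first by exists (g w), M, N, I, J, w.
  by exists 0 => _ [M1 [N1 [I1 [J1 [w1 [_ [_ ->]]]]]]].
by exists M', N', I', J', w'; split=> //; split=> //; exact: ltW.
Qed.

End FiniteHull.
End DualTensorNorms.

Section TensorDual.
Context (R : realType) (k : scalar_kind).
Local Notation K := (scalar_field R k).
Local Notation KS := (scalar_space R k).
Local Notation banach := (completeNormedModType K).
Local Notation duality w z := (pairing (@coev R k _) (@coev R k _) w z).
Implicit Types alpha beta : tensor_family R k.

(** The form in which an infimum is approached below: the error stays inside the
    product. *)
Lemma ler_mul_approx (x c y : R) : 0 <= c ->
  (forall e, 0 < e -> x <= c * (y + e)) -> x <= c * y.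
Proof.
move=> c0 H; apply/ler_addgt0Pr => e e0.
have c1 : 0 < c + 1 by lra.
have ec : 0 < e / (c + 1) by rewrite divr_gt0.
rewrite (le_trans (H _ ec))// mulrDr lerD2l mulrCA ler_piMr ?(ltW e0)//.
by rewrite ler_pdivrMr//; lra.
Qed.

Lemma dual_norm_fin_map alpha (M N M' N' : banach) (S : operator M M')
    (T : operator N N') (w : tensor M N) : uniform_crossnorm alpha ->
  dual_norm_fin alpha (tensor_map S T w)
    <= opnorm S * opnorm T * dual_norm_fin alpha w.
Proof.
move=> a; have al := uniform_crossnorm_like a.
have ST0 : 0 <= opnorm S * opnorm T by rewrite mulr_ge0 ?opnorm_ge0.
apply: (dual_norm_fin_le al) => [|z].
  by rewrite mulr_ge0 ?dual_norm_fin_ge0.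
rewrite (@pairing_map R k _ _ _ _ _ _ _ _ _ _ (@coev R k M) (@coev R k N)
  S T (adjoint S) (adjoint T))//.
rewrite (le_trans (dual_norm_finP _ _ al))//.
rewrite mulrAC [leRHS]mulrC ler_wpM2l ?dual_norm_fin_ge0//.
rewrite (le_trans (crossnorm_map a _ _ _))// ler_wpM2r ?(cross_ge0 al)//.
by rewrite ler_pM ?opnorm_ge0 ?opnorm_adjoint.
Qed.

(** For embeddings this is the definition of the hull; in general the tensor is
    moved to the ranges of [S] and [T] first. *)
Lemma tensor_dual_map alpha (M N Y X : banach) (S : operator M Y)
    (T : operator N X) (w : tensor M N) : uniform_crossnorm alpha ->
  finite_dim M -> finite_dim N ->
  tensor_dual alpha (tensor_map S T w)
    <= opnorm S * opnorm T * dual_norm_fin alpha w.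
Proof.
move=> a Mf Nf; have al := uniform_crossnorm_like a.
have [E [i [S0 [Ef ii <- SS]]]] := range_factorization S Mf.
have [F [j [T0 [Ff jj <- TT]]]] := range_factorization T Nf.
have d0 (M1 N1 : banach) (w1 : tensor M1 N1) := dual_norm_fin_ge0 w1 al.
rewrite -tensor_map_comp.
rewrite (le_trans (finite_hull_le d0 _ Ef Ff ii jj))//.
rewrite (le_trans (dual_norm_fin_map _ _ _ a))// ler_wpM2r ?d0//.
by rewrite ler_pM ?opnorm_ge0.
Qed.

Lemma tensor_dual_le_fin alpha (M N : banach) (w : tensor M N) :
  crossnorm_like alpha -> finite_dim M -> finite_dim N ->
  tensor_dual alpha w <= dual_norm_fin alpha w.
Proof.
move=> a Mf Nf; rewrite -{1}[w]tensor_map_id; apply: finite_hull_le => //.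
by move=> M1 N1 w1; exact: dual_norm_fin_ge0.
Qed.

Lemma tensor_dual_like alpha : uniform_crossnorm alpha ->
  crossnorm_like (tensor_dual alpha).
Proof.
move=> a; have al := uniform_crossnorm_like a.
have d0 (M1 N1 : banach) (w1 : tensor M1 N1) := dual_norm_fin_ge0 w1 al.
split=> [X Y u|X Y c u|X Y f g u].
- exact: finite_hull_ge0.
- apply: ler_mul_approx => [|e e0]; first exact: rpart_norm_ge0.
  have [M [N [I [J [w [[Mf Nf Ii Ji] [<- we]]]]]]] := finite_hull_approx d0 u e0.
  rewrite -tensor_mapZ (le_trans (finite_hull_le d0 _ Mf Nf Ii Ji))//.
  rewrite (le_trans _ (ler_wpM2l (rpart_norm_ge0 c) we))//.
  apply: (dual_norm_fin_le al) => [|z].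
    by rewrite mulr_ge0 ?rpart_norm_ge0.
  rewrite pairingZl rnormZ -mulrA ler_wpM2l ?rpart_norm_ge0//.
  exact: dual_norm_finP.
- apply: ler_mul_approx => [|e e0]; first by rewrite mulr_ge0 ?opnorm_ge0.
  have [M [N [I [J [w [[Mf Nf Ii Ji] [<- we]]]]]]] := finite_hull_approx d0 u e0.
  have -> : tensor_map I J w (form_prod (op_fun f) (op_fun g)) =
      duality w (tens (adjoint I f) (adjoint J g)).
    by rewrite /pairing /=; apply: tensor_form_ext.
  rewrite (le_trans (dual_norm_finP _ _ al))// mulrC.
  rewrite ler_pM ?(cross_ge0 al) ?d0//.
  rewrite (le_trans (crossnorm_tens a _ _))// !rnorm_operator.
  have oa (U V : banach) (L : operator U V) (h : dual V) :
      isometric_embedding L -> opnorm (adjoint L h) <= opnorm h.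
    move=> Li; rewrite (le_trans (opnorm_comp h L))// ler_piMr ?opnorm_ge0//.
    exact: opnorm_isometric.
  by rewrite ler_pM ?opnorm_ge0 ?oa.
Qed.

(** Trace duality: [alpha] and its dual norm bound each other's pairing on all
    Banach spaces, because the dual norm is generated from below by
    finite-dimensional spaces whose inclusions can be transposed onto the other
    factor. *)
Lemma duality_bound alpha (M N : banach) (w : tensor M N)
    (t : tensor (dual M) (dual N)) : uniform_crossnorm alpha ->
  rnorm (duality w t) <= alpha M N w * tensor_dual alpha t.
Proof.
move=> a; have al := uniform_crossnorm_like a.
have d0 (M1 N1 : banach) (w1 : tensor M1 N1) := dual_norm_fin_ge0 w1 al.
apply: ler_mul_approx => [|e e0]; first exact: (cross_ge0 al).
have [E [F [I [J [t' [[Ef Ff Ii Ji] [<- te]]]]]]] := finite_hull_approx d0 t e0.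
rewrite pairing_coevC.
rewrite (@pairing_map R k _ _ _ _ _ _ _ _ _ _ (@coev R k E) (@coev R k F)
  I J (preadjoint I) (preadjoint J))//.
rewrite (le_trans (dual_norm_finP _ _ al))// mulrC.
rewrite ler_pM ?(cross_ge0 al) ?d0//.
rewrite (le_trans (crossnorm_map a _ _ _))// ler_piMl ?(cross_ge0 al)//.
rewrite -[leRHS]mulr1 ler_pM ?opnorm_ge0//.
  exact: le_trans (opnorm_preadjoint I) (opnorm_isometric Ii).
exact: le_trans (opnorm_preadjoint J) (opnorm_isometric Ji).
Qed.

End TensorDual.

(** * Ideals associated with an adjoint tensor norm *)

Section AdjointIdeal.
Context (R : realType) (k : scalar_kind).
Local Notation K := (scalar_field R k).
Local Notation KS := (scalar_space R k).
Local Notation banach := (completeNormedModType K).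

Section IdealNorm.
Variable B : banach_ideal R k.

Lemma ideal_normN (X Y : banach) (T : operator X Y) :
  in_ideal B T -> ideal_norm B (- T) = ideal_norm B T.
Proof.
by move=> BT; rewrite -scaleN1r ideal_normZ// normrN rpart_norm1 mul1r.
Qed.

Lemma ideal_norm0 (X Y : banach) : ideal_norm B (0 : operator X Y) = 0.
Proof.
have B0 : in_ideal B (0 : operator X Y).
  by have := ideal_finite_rank B (@finite_rank_sum R k X Y [::]); rewrite big_nil.
by rewrite -[X in ideal_norm B X](scale0r 0) ideal_normZ// rpart_norm0 mul0r.
Qed.

Lemma ideal_norm_ge0 (X Y : banach) (T : operator X Y) :
  in_ideal B T -> 0 <= ideal_norm B T.
Proof.
move=> BT; have BN : in_ideal B (- T).
  by rewrite -scaleN1r; exact: ideal_scale.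
have := ideal_normD BT BN; rewrite subrr ideal_norm0 ideal_normN//.
by rewrite -mulr2n pmulrn_lge0.
Qed.

End IdealNorm.

Context (alpha : tensor_family R k) (B : banach_ideal R k).
Hypothesis alphaP : uniform_crossnorm alpha.
Hypothesis Balpha : associated B (tensor_adjoint alpha).

Let al := uniform_crossnorm_like alphaP.
Let d0 (M1 N1 : banach) (w1 : tensor M1 N1) := dual_norm_fin_ge0 w1 al.

Lemma associated_adjoint (M N : banach) (s : seq (dual M * N)) :
  finite_dim M -> finite_dim N ->
  ideal_norm B (\sum_(p <- s) rank_one p.1 p.2)
    = tensor_dual alpha (\sum_(p <- s) tens p.2 p.1).
Proof.
by move=> Mf Nf; rewrite Balpha// /tensor_adjoint /tensor_transpose tensor_swap_sum.
Qed.

(** Functionals separate the points of [Y], and a functional of a value of the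
    operator is a product functional of the tensor. *)
Lemma tensor_operator_eq (X Y : banach) (s t : seq (Y * dual X)) :
  \sum_(p <- s) tens p.1 p.2 = \sum_(p <- t) tens p.1 p.2 ->
  \sum_(p <- s) rank_one p.2 p.1 = \sum_(p <- t) rank_one p.2 p.1
    :> operator X Y.
Proof.
move=> st; apply: opE => x; apply/eqP; rewrite -subr_eq0; apply/eqP.
have [f _ fE] := norming_functional
  (op_fun (\sum_(p <- s) rank_one p.2 p.1) x -
   op_fun (\sum_(p <- t) rank_one p.2 p.1) x).
apply/(@rnorm0_eq0 R k Y)/(@rembed_inj R k); rewrite -fE rembed0.
have H (r : seq (Y * dual X)) :
    op_fun f (op_fun (\sum_(p <- r) rank_one p.2 p.1) x) =
    tensor_fun (\sum_(p <- r) tens p.1 p.2)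
      (form_prod (op_fun f) (op_fun (eval_at x))).
  rewrite op_sumE linear_sum tensor_sumE; apply: eq_bigr => p _.
  by rewrite linearZ /= /form_prod /= mulrC.
by rewrite linearB /= !H st subrr.
Qed.

(** A representation of the tensor on subspaces [M] of [Y] and [N] of [X^*]
    factors the operator through a map [N^* -> M], whose ideal norm is a dual
    tensor norm because [N^*] and [M] are finite-dimensional. *)
Lemma ideal_norm_le_tensor_dual (X Y : banach) (s : seq (Y * dual X)) :
  ideal_norm B (\sum_(p <- s) rank_one p.2 p.1 : operator X Y)
    <= tensor_dual alpha (\sum_(p <- s) tens p.1 p.2).
Proof.
apply/ler_addgt0Pr => e e0.
have [M [N [I [J [w [[Mf Nf Ii Ji] [ws we]]]]]]] :=
  finite_hull_approx d0 (\sum_(p <- s) tens p.1 p.2) e0.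
apply: le_trans we; have [t wt] := banach_tensor_decomposition w.
rewrite wt tensor_map_sum in ws.
have -> : \sum_(p <- s) rank_one p.2 p.1 =
    op_comp I (op_comp (\sum_(p <- t) rank_one (eval_at p.2) p.1)
      (preadjoint J)).
  rewrite -(@tensor_operator_eq _ _ [seq (I p.1, J p.2) | p <- t] s); last first.
    by rewrite big_map.
  rewrite big_map; apply: opE => x /=; rewrite !op_sumE linear_sum.
  by apply: eq_bigr => p _; rewrite linearZ.
have Wf := @finite_rank_sum R k (dual N) M [seq (eval_at p.2, p.1) | p <- t].
have := ideal_norm_comp I (preadjoint J) (ideal_finite_rank B Wf).
have := @associated_adjoint (dual N) M [seq (eval_at p.2, p.1) | p <- t]
  (finite_dim_dual Nf) Mf.
rewrite !big_map /= => -> /le_trans; apply.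
have -> : \sum_(p <- t) tens p.1 (eval_at p.2) =
    tensor_map (op_id M) (bidual N) w.
  by rewrite wt tensor_map_sum.
have ii : isometric_embedding (op_id M) by [].
have bi := @bidual_isometric R k N.
have le := finite_hull_le d0 w Mf Nf ii bi.
apply: le_trans le.
have h0 := finite_hull_ge0 d0 (tensor_map (op_id M) (bidual N) w).
rewrite -mulrA mulrCA ler_piMr// -[leRHS]mulr1 ler_pM ?opnorm_ge0//.
  exact: opnorm_isometric.
exact: le_trans (opnorm_preadjoint J) (opnorm_isometric Ji).
Qed.

(** An operator of the ideal acts on [Y^* (x) X] through the trace, with norm at
    most its ideal norm: after compression to finite-dimensional spaces this is
    the duality between [alpha] and its dual norm. *)
Lemma ideal_trace_bound (X Y : banach) (T : operator X Y)
    (u : tensor (dual Y) X) : finitely_generated alpha -> in_ideal B T ->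
  rnorm (u (form_comp (op_id (dual Y)) T (@ev R k Y)))
    <= ideal_norm B T * alpha u.
Proof.
move=> afg BT; have T0 := ideal_norm_ge0 BT; rewrite (afg _ _ u).
apply: ler_mul_approx => // e e0.
have [M [N [I [J [w [[Mf Nf Ii Ji] [<- we]]]]]]] :=
  finite_hull_approx (cross_ge0 al) u e0.
pose Q := preadjoint I.
have [s sE] := finite_dim_op (op_comp Q (op_comp T J)) Nf.
have TQ : ideal_norm B (op_comp Q (op_comp T J)) <= ideal_norm B T.
  rewrite (le_trans (ideal_norm_comp _ _ BT))//.
  rewrite mulrAC ler_piMl//.
  rewrite -[leRHS]mulr1 ler_pM ?opnorm_ge0 ?(opnorm_isometric Ji)//.
  exact: le_trans (opnorm_preadjoint I) (opnorm_isometric Ii).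
have -> : tensor_map I J w (form_comp (op_id (dual Y)) T (@ev R k Y)) =
    pairing (@coev R k M) (@coev R k N) w (\sum_(p <- s) tens p.2 p.1).
  rewrite /pairing /=; apply: tensor_form_ext => m n /=.
  rewrite /pairing_form tensor_sumE.
  transitivity (op_fun (op_fun (op_comp Q (op_comp T J)) n) m : KS) => //.
  rewrite sE rank_one_sumE op_sumE; apply: eq_bigr => p _.
  by rewrite /= /form_prod /= mulrC.
rewrite (le_trans (duality_bound _ _ alphaP))// mulrC.
rewrite ler_pM ?(cross_ge0 al) ?(cross_ge0 (tensor_dual_like alphaP))//.
rewrite -associated_adjoint -?sE//; exact: finite_dim_dual.
Qed.

Lemma ideal_predual_trace_bound (X Z : banach) (T : operator X (dual Z))
    (u : tensor Z X) : finitely_generated alpha -> in_ideal B T ->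
  rnorm (u (form_comp (op_id Z) T (@coev R k Z)))
    <= ideal_norm B T * alpha u.
Proof.
move=> afg BT.
have := ideal_trace_bound (tensor_map (bidual Z) (op_id X) u) afg BT.
have -> : tensor_map (bidual Z) (op_id X) u
      (form_comp (op_id (dual (dual Z))) T (@ev R k (dual Z))) =
    u (form_comp (op_id Z) T (@coev R k Z)).
  by rewrite /=; apply: tensor_form_ext.
move=> /le_trans; apply; rewrite ler_wpM2l ?ideal_norm_ge0//.
rewrite (le_trans (crossnorm_map alphaP _ _ _))// ler_piMl ?(cross_ge0 al)//.
rewrite -[leRHS]mulr1 ler_pM ?opnorm_ge0 ?opnorm_id//.
exact/opnorm_isometric/bidual_isometric.
Qed.

End AdjointIdeal.

(** * The approximation property of [X] and approximation of operators on [X] *)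

Section Approximation.
Context (R : realType) (k : scalar_kind).
Local Notation K := (scalar_field R k).
Local Notation KS := (scalar_space R k).
Local Notation banach := (completeNormedModType K).
Context (alpha : tensor_family R k) (B : banach_ideal R k).
Hypothesis alphaP : uniform_crossnorm alpha.
Hypothesis alpha_fg : finitely_generated alpha.
Hypothesis Balpha : associated B (tensor_adjoint alpha).

Let al := uniform_crossnorm_like alphaP.

Lemma finite_rankD (X Y : banach) (S T : operator X Y) :
  finite_rank S -> finite_rank T -> finite_rank (S + T).
Proof.
move=> /finite_rank_decomposition[s ->] /finite_rank_decomposition[t ->].
by rewrite -big_cat; exact: finite_rank_sum.
Qed.

Lemma finite_rankZ (X Y : banach) (a : K) (T : operator X Y) :
  finite_rank T -> finite_rank (a *: T).
Proof.
move=> /finite_rank_decomposition[s ->].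
have -> : a *: (\sum_(p <- s) rank_one p.1 p.2) =
    \sum_(p <- [seq (p.1, a *: p.2) | p <- s]) rank_one p.1 p.2 :> operator X Y.
  rewrite big_map scaler_sumr; apply: eq_bigr => p _; apply: opE => x /=.
  by rewrite [RHS]scalerA [LHS]scalerA; congr (_ *: _); exact: mulrC.
exact: finite_rank_sum.
Qed.

(** Put [c = lambda |T| + e].  If no finite rank operator of ideal norm at most
    [c] were close to [T] at the given points, a functional would
    separate; it is a tensor [u] of [Y^* (x) X] whose trace with [T] is at least
    [1] while its traces with the unit ball of the dual norm are at most [1 / c],
    and the approximation property then contradicts the trace bound of [T]. *)
Lemma pointwise_approximation (X Y : banach) (lambda e : R)
    (T : operator X Y) n (x : 'I_n -> X) :
  0 <= lambda -> 0 < e -> bounded_approx alpha lambda X -> in_ideal B T ->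
  exists S : operator X Y, [/\ finite_rank S,
    ideal_norm B S <= lambda * ideal_norm B T + e &
    forall i, rnorm (T (x i) - S (x i)) <= e].
Proof.
move=> l0 e0 Xap BT; have T0 := ideal_norm_ge0 BT.
pose c := lambda * ideal_norm B T + e.
have c0 : 0 < c by rewrite ltr_wpDl// mulr_ge0.
pose L (S : operator X Y) : 'I_n -> Y := fun i => S (x i).
have Ll : linear L by [].
pose LL : {linear operator X Y -> ('I_n -> Y)} :=
  HB.pack L (GRing.isLinear.Build K (operator X Y) ('I_n -> Y) *:%R L Ll).
pose p (S : operator X Y) := c^-1 * ideal_norm B S.
have ci : 0 <= c^-1 by rewrite invr_ge0 ltW.
have ei : 0 <= e^-1 by rewrite invr_ge0 ltW.
pose q (z : 'I_n -> Y) : R := e^-1 * tuple_norm z.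
have qs : seminorm q := tuple_norm_seminorm Y n ei.
pose D : set (operator X Y) := [set S | finite_rank S].
have DB S : D S -> in_ideal B S by exact: ideal_finite_rank.
have D0 : D 0 by have := @finite_rank_sum R k X Y [::]; rewrite big_nil.
have DD (S S' : operator X Y) : D S -> D S' -> D (S + S') by exact: finite_rankD.
have DZ a (S : operator X Y) : D S -> D (a *: S) by exact: finite_rankZ.
have p0 S : D S -> 0 <= p S.
  by move=> DS; rewrite mulr_ge0// ideal_norm_ge0//; exact: DB.
have pD S S' : D S -> D S' -> p (S + S') <= p S + p S'.
  by move=> DS DS'; rewrite -mulrDr ler_wpM2l// ideal_normD//; exact: DB.
have pZ a S : D S -> p (a *: S) <= rpart `|a| * p S.
  by move=> DS; rewrite mulrCA /p ideal_normZ//; exact: DB.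
pose m := inf_convolution D p q LL.
have ms : seminorm m by exact: inf_convolution_seminorm.
have mle z S : D S -> m z <= p S + q (z - L S) by exact: inf_convolution_le.
pose z0 := L T.
have [m1|m1] := ltP (m z0) 1.
  have [_ [S DS <-] Sm] : exists2 r, [set p S + q (z0 - LL S) | S in D] r & r < 1.
    have [||r Ar rm] := @inf_adherent _ [set p S + q (z0 - LL S) | S in D] (1 - m z0).
    - by rewrite subr_gt0.
    - split; first by exists (p 0 + q (z0 - LL 0)), 0.
      by exists 0 => _ [y Dy <-]; rewrite addr_ge0 ?p0 ?seminorm_ge0.
    - by exists r => //; rewrite (lt_le_trans rm)// addrC subrK.
  have qz0 : 0 <= q (z0 - L S) by exact: seminorm_ge0.
  exists S; split=> // [|i].
    have : p S <= 1 by have := p0 S DS; have := Sm; rewrite -[LL S]/(L S); lra.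
    by rewrite /p mulrC ler_pdivrMr// mul1r.
  have : q (z0 - L S) <= 1 by have := p0 S DS; have := Sm; rewrite -[LL S]/(L S); lra.
  rewrite /q mulrC ler_pdivrMr// mul1r; apply: le_trans.
  exact: (tuple_norm_ge (z0 - L S) i).
have [psi [psil psiz psim]] := seminorm_attained z0 ms.
have psiq z : rpart `|psi z : K| <= e^-1 * tuple_norm z.
  rewrite (le_trans (psim z))// (le_trans (mle z 0 D0))//.
  by rewrite /p ideal_norm0 mulr0 add0r -[L 0]/(0 : 'I_n -> Y) subr0.
have [g psig _] := tuple_functional psil ei psiq.
pose u : tensor (dual Y) X := \sum_(i < n) tens (g i) (x i).
have uS (S : operator X Y) : psi (L S) =
    u (form_comp (op_id (dual Y)) S (@ev R k Y)).
  by rewrite psig /u tensor_sumE.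
have u1 : (functional_norm (tensor_dual alpha (X:=Y) (Y:=dual X))
            (pairing (@ev R k Y) (@coev R k X) u) <= (c^-1)%:E)%E.
  apply: functional_norm_le => v v1.
  have [s vs] := banach_tensor_decomposition v.
  pose S : operator X Y := \sum_(p <- s) rank_one p.2 p.1.
  have DS : D S by have := @finite_rank_sum R k X Y [seq (p.2, p.1) | p <- s];
    rewrite big_map.
  have -> : pairing (@ev R k Y) (@coev R k X) u v = psi (L S).
    rewrite uS /pairing; apply: tensor_form_ext => f y /=.
    rewrite /pairing_form vs tensor_sumE.
    rewrite /form_comp /= /ev op_sumE linear_sum; apply: eq_bigr => r _.
    by rewrite linearZ /= /form_prod /= mulrC.
  rewrite (le_trans (psim _))// (le_trans (mle _ _ DS))//.
  rewrite subrr -(scale0r 0) qs.2 rpart_norm0 mul0r addr0 /p.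
  rewrite ler_piMr// (le_trans (ideal_norm_le_tensor_dual alphaP Balpha s))//.
  by rewrite -vs.
have au : alpha u <= lambda * c^-1.
  have := Xap Y u; rewrite -lee_fin EFinM => /le_trans; apply.
  by rewrite lee_wpmul2l// lee_fin.
have : 1 <= ideal_norm B T * alpha u.
  rewrite (le_trans m1)//.
  have := ideal_trace_bound alphaP Balpha u alpha_fg BT.
  rewrite -uS -/z0 psiz; apply: le_trans.
  by rewrite rnorm_scalar rpart_norm_rembed// seminorm_ge0.
move=> /le_trans /(_ (ler_wpM2l T0 au)).
rewrite mulrA ler_pdivlMr// mul1r /c mulrC gerDl.
by rewrite leNgt e0.
Qed.

Lemma net_filter_filter (I : Type) (le : I -> I -> Prop) :
  directed le -> ProperFilter (net_filter le).
Proof.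
move=> [[i0 _] le_refl le_trans le_up]; apply: filter_from_proper; last first.
  by move=> i _; exists i; exact: le_refl.
apply: filter_from_filter; first by exists i0.
move=> i j _ _; have [l [il jl]] := le_up i j; exists l => // m lm.
by split; [exact: le_trans il lm|exact: le_trans jl lm].
Qed.

(** The approximants are indexed by finite sets of points and tolerances. *)
Theorem bounded_approx_local (X : banach) (lambda : R) : 0 <= lambda ->
  bounded_approx alpha lambda X -> local_bounded_approx B lambda X.
Proof.
move=> l0 Xap Y T BT.
pose I := (seq X * {e : R | 0 < e})%type.
pose le (i j : I) : Prop :=
  {subset i.1 <= j.1} /\ sval j.2 <= sval i.2.
have dle : directed le.
  split.
  - by exists ([::], exist _ 1 ltr01).
  - by move=> i; split.
  - move=> i j l [ij ji] [jl lj]; split; last exact: le_trans lj ji.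
    by move=> x /ij /jl.
  - move=> [s [d d0]] [t [e e0]].
    have de : 0 < Num.min d e by rewrite lt_min d0.
    exists (s ++ t, exist _ (Num.min d e) de); split; split=> //=.
    + by move=> x xs; rewrite mem_cat xs.
    + by rewrite ge_min lexx.
    + by move=> x xs; rewrite mem_cat xs orbT.
    + by rewrite ge_min lexx orbT.
have /choice[S SP] (i : I) : exists S : operator X Y, [/\ finite_rank S,
    ideal_norm B S <= lambda * ideal_norm B T + sval i.2 &
    forall x, x \in i.1 -> rnorm (T x - S x) <= sval i.2].
  case: i => s [e e0] /=.
  have [S [Sf SB Sx]] := pointwise_approximation
    (fun j : 'I_(size s) => s`_j) l0 e0 Xap BT.
  exists S; split=> // x /(nthP 0)[j js <-]; exact: (Sx (Ordinal js)).
have FF := net_filter_filter dle.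
exists I, le, S; split=> // [i|x|].
- by have [] := SP i.
- apply/cvgrPdist_le => e e0.
  have e0' : 0 < rpart e.
    rewrite lt_neqAle; apply/andP; split; last first.
      by rewrite -(rembed_le k) rembed0 rpartK ltW.
    apply/eqP => e00; have := e0; rewrite -(rpartK (ltW e0)) -e00 rembed0.
    by rewrite ltxx.
  exists ([:: x], exist _ (rpart e) e0') => // i [/= xi ie].
  rewrite -(rpartK (ltW e0)) -rnormE rembed_le.
  have [_ _ Sx] := SP i; rewrite (le_trans (Sx x _))//.
  by apply: xi; rewrite inE.
- apply/lee_addgt0Pr => e e0.
  apply: (@le_trans _ _ (ereal_sup [set (ideal_norm B (S j))%:E |
      j in [set j | le ([::], exist _ e e0) j]])).
    by apply: ereal_inf_lbound; exists ([::], exist _ e e0).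
  apply: ge_ereal_sup => _ [j /= [_ je] <-].
  have [_ Sj _] := SP j; rewrite -EFinD lee_fin (le_trans Sj)//.
  by rewrite lerD2l.
Qed.

End Approximation.

(** * From local approximation to bounded approximation *)

Section LocalToBounded.
Context (R : realType) (k : scalar_kind).
Local Notation K := (scalar_field R k).
Local Notation KS := (scalar_space R k).
Local Notation banach := (completeNormedModType K).
Context (alpha : tensor_family R k) (B : banach_ideal R k).
Hypothesis alphaP : uniform_crossnorm alpha.
Hypothesis alpha_fg : finitely_generated alpha.
Hypothesis Balpha : associated B (tensor_adjoint alpha).

Let al := uniform_crossnorm_like alphaP.
Let al' := tensor_dual_like alphaP.
Let d0 (M1 N1 : banach) (w1 : tensor M1 N1) := dual_norm_fin_ge0 w1 al.

(** A functional on [Y^* (x) X] is the trace against the operator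
    [x |-> (f |-> psi (f (x) x))] into [Y^{**}]. *)
Lemma operator_of_functional (X Y : banach) (psi : tensor (dual Y) X -> KS) :
  linear psi -> (forall w, rpart `|psi w : K| <= alpha w) ->
  exists T : operator X (dual (dual Y)),
    forall w, psi w = w (form_comp (op_id (dual Y)) T (@coev R k (dual Y))).
Proof.
move=> psil psia.
pose PP : {linear tensor (dual Y) X -> KS} :=
  HB.pack psi (GRing.isLinear.Build K (tensor (dual Y) X) KS *:%R psi psil).
have tl (x : X) : linear (fun f : dual Y => psi (tens f x)).
  move=> a f g; rewrite -psil; congr psi; apply: tensorP => C /=.
  by rewrite linearPl.
have tr (f : dual Y) : linear (fun x : X => psi (tens f x)).
  move=> a x y; rewrite -psil; congr psi; apply: tensorP => C /=.
  by rewrite linearPr.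
have tb (f : dual Y) (x : X) : rpart `|psi (tens f x) : K| <= rnorm x * rnorm f.
  by rewrite (le_trans (psia _))// mulrC crossnorm_tens.
have /choice[T0 T0P] (x : X) : exists F : dual (dual Y),
    (forall f, op_fun F f = psi (tens f x)) /\ opnorm F <= rnorm x.
  have [F FE Fx] := op_of_bound (tl x) (rnorm_ge0 x) (fun f => tb f x).
  by exists F.
have T0l : linear T0.
  move=> a x y; apply: opE => f; rewrite (T0P _).1 tr.
  by rewrite -(T0P x).1 -(T0P y).1.
have T0b x : rnorm (T0 x) <= 1 * rnorm x.
  by rewrite mul1r rnorm_operator; exact: (T0P x).2.
have [T TE _] := op_of_bound T0l ler01 T0b.
exists T => w; have [s ->] := banach_tensor_decomposition w.
rewrite tensor_sumE -[LHS]/(PP _) linear_sum; apply: eq_bigr => p _.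
by rewrite /= /form_comp /= /coev TE (T0P _).1.
Qed.

(** Functionals on [Y^* (x)_alpha X] are operators of the adjoint ideal: a
    finite-dimensional compression of the operator into [Y^{**}] leads to
    functionals in [Y^{***}], which local reflexivity moves back to [Y^*]. *)
Lemma representing_operator_in_ideal (X Y : banach)
    (T : operator X (dual (dual Y))) : maximal_ideal B ->
  (forall w : tensor (dual Y) X,
    rnorm (w (form_comp (op_id (dual Y)) T (@coev R k (dual Y)))) <= alpha w) ->
  in_ideal B T /\ ideal_norm B T <= 1.
Proof.
move=> Bmax Ta; apply: Bmax => M N I Q Mf Nf Ii [_ Qn].
have Q1 : opnorm Q <= 1.
  apply: opnorm_le => // y; rewrite mul1r Qn; apply: ge_inf; last by exists y.
  by exists 0 => _ [z _ <-]; exact: rnorm_ge0.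
have [s sE] := finite_dim_op (op_comp Q (op_comp T I)) Mf.
rewrite sE (associated_adjoint Balpha)//.
have Mdf := finite_dim_dual Mf.
rewrite (le_trans (tensor_dual_le_fin _ al Nf Mdf))//.
apply: (dual_norm_fin_le al) => // z; rewrite mul1r.
have [r zE] := banach_tensor_decomposition z.
have [J J1 JE] := finite_dim_reflexive Mf.
have zT : pairing (@coev R k N) (@coev R k (dual M)) (\sum_(p <- s) tens p.2 p.1) z
    = \sum_(p <- [seq (q.1, T (I (J q.2))) | q <- r])
        op_fun (op_fun (adjoint Q) p.1) p.2.
  rewrite big_map pairing_coevC.
  rewrite zE /pairing tensor_sumE; apply: eq_bigr => q _ /=.
  rewrite /pairing_form tensor_sumE.
  transitivity (op_fun q.1 (op_fun (op_comp Q (op_comp T I)) (J q.2))) => //.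
  rewrite sE rank_one_sumE linear_sum; apply: eq_bigr => p _.
  by rewrite linearZ /= /form_prod /= [LHS]mulrC /ev -{1}(JE q.2).
rewrite zT.
have a0 := cross_ge0 al z.
have := @local_reflexivity R k (dual N) (dual Y) (adjoint Q)
  [seq (q.1, T (I (J q.2))) | q <- r] (alpha z) (finite_dim_dual Nf) a0.
move=> H; apply: le_trans (H _) _; last first.
  by rewrite ler_piMr// (le_trans (opnorm_adjoint Q)).
move=> U; rewrite big_map /=.
have -> : \sum_(q <- r) op_fun (T (I (J q.2))) (U q.1) =
    tensor_map U (op_comp I J) z (form_comp (op_id (dual Y)) T (@coev R k (dual Y))).
  by rewrite zE tensor_map_sum tensor_sumE.
rewrite (le_trans (Ta _))// (le_trans (crossnorm_map alphaP _ _ _))//.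
rewrite mulrC ler_wpM2l// ler_piMr ?opnorm_ge0//.
rewrite (le_trans (opnorm_comp I J))// -[leRHS]mulr1 ler_pM ?opnorm_ge0//.
exact: opnorm_isometric.
Qed.

(** The trace against a fixed tensor sees finitely many values of the operator,
    so it is continuous for pointwise convergence. *)
Lemma local_approx_trace (X Z : banach) (lambda e : R)
    (T : operator X (dual Z)) (w : tensor Z X) :
  local_bounded_approx B lambda X -> in_ideal B T -> 0 < e ->
  exists S : operator X (dual Z), [/\ finite_rank S,
    ideal_norm B S <= lambda * ideal_norm B T + e &
    rnorm (w (form_comp (op_id Z) T (@coev R k Z))
         - w (form_comp (op_id Z) S (@coev R k Z))) <= e].
Proof.
move=> Xap BT e0; have [I [le [S [dle Sf Sx Sl]]]] := Xap _ T BT.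
have FF := net_filter_filter dle.
have [s sE] := banach_tensor_decomposition w.
have wE (U : operator X (dual Z)) : w (form_comp (op_id Z) U (@coev R k Z)) =
    \sum_(p <- s) op_fun (U p.2) p.1 by rewrite sE tensor_sumE.
have scvg : \sum_(p <- s) op_fun (S j p.2) p.1 @[j --> net_filter le] -->
    (\sum_(p <- s) op_fun (T p.2) p.1 : KS).
  elim: (s) => [|p r IH].
    rewrite big_nil; under eq_fun => j do rewrite big_nil.
    exact: cvg_cst.
  rewrite big_cons; under eq_fun => j do rewrite big_cons.
  apply: cvgD => //.
  apply: (@continuous_cvg _ _ _ _ FF (fun j => S j p.2) (eval_at p.1)) => //.
  exact: op_continuous.
have e0' : 0 < rembed k e :> K.
  rewrite lt_neqAle -(rembed0 R k) rembed_le ltW// andbT.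
  by apply/eqP => /rembed_inj e00; move: e0; rewrite -e00 ltxx.
have near1 : \forall j \near net_filter le,
    rnorm (w (form_comp (op_id Z) T (@coev R k Z))
         - w (form_comp (op_id Z) (S j) (@coev R k Z))) <= e.
  move/cvgrPdist_le : scvg => /(_ _ e0'); apply: filterS => j.
  by rewrite !wE -rnormE rembed_le.
have near2 : \forall j \near net_filter le,
    ideal_norm B (S j) <= lambda * ideal_norm B T + e.
  have : (net_limsup le (fun j => ideal_norm B (S j)) <
      (lambda * ideal_norm B T + e)%:E)%E.
    by apply: le_lt_trans Sl _; rewrite lte_fin ltrDl.
  move=> /ereal_inf_lt[_ [i _ <-] ilt]; exists i => // j ij /=.
  rewrite -lee_fin; apply: le_trans (ltW ilt); apply: ereal_sup_ubound.
  by exists j.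
have [j [j1 j2]] := filter_ex (filterI near1 near2).
by exists (S j); split.
Qed.

Lemma functional_sum (X : banach) (F : dual X) I (s : seq I) (c : I -> K)
    (x : I -> X) :
  op_fun F (\sum_(i <- s) c i *: x i)
    = \sum_(i <- s) (c i * (op_fun F (x i) : K) : KS).
Proof. by rewrite linear_sum; apply: eq_bigr => i _; rewrite linearZ. Qed.

Lemma pairing_form_functional (X Y : banach)
    (s : seq (dual X * dual (dual Y))) (g : dual Y) (F : dual (dual X)) :
  pairing_form (@coev R k (dual Y)) (@ev R k (dual X))
    (\sum_(p <- s) tens p.2 p.1) g F
  = op_fun F (\sum_(p <- s) (op_fun p.2 g : K) *: p.1).
Proof.
by rewrite /pairing_form tensor_sumE functional_sum.
Qed.

Lemma bidual_pairing_sum (X Y M N : banach) (s : seq (dual X * dual (dual Y)))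
    (I : operator M (dual Y)) (J : operator N (dual (dual X)))
    (t : seq (M * N)) (f : M -> dual X) :
  (forall m, f m = \sum_(p <- s) (op_fun p.2 (I m) : K) *: p.1) ->
  pairing (@ev R k (dual Y)) (@coev R k (dual X)) (\sum_(p <- s) tens p.2 p.1)
    (tensor_map I J (\sum_(p <- t) tens p.1 p.2))
  = \sum_(q <- [seq (q.2, f q.1) | q <- t]) op_fun (op_fun J q.1) q.2.
Proof.
move=> fE; rewrite pairing_evC big_map tensor_map_sum /pairing tensor_sumE.
apply: eq_bigr => q _ /=; rewrite fE; exact: pairing_form_functional.
Qed.

Lemma operator_trace_sum (X Y M N : banach) (s : seq (dual X * dual (dual Y)))
    (I : operator M (dual Y)) (U : operator N X)
    (t : seq (M * N)) (f : M -> dual X) :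
  (forall m, f m = \sum_(p <- s) (op_fun p.2 (I m) : K) *: p.1) ->
  \sum_(q <- t) op_fun (f q.1) (U q.2) =
    tensor_map I U (\sum_(p <- t) tens p.1 p.2)
      (form_comp (op_id (dual Y)) (\sum_(p <- s) rank_one p.1 p.2)
         (@coev R k (dual Y))).
Proof.
move=> fE; rewrite tensor_map_sum tensor_sumE; apply: eq_bigr => q _.
rewrite /= /form_comp /= /coev fE !op_sumE; apply: eq_bigr => p _ /=.
exact: mulrC.
Qed.

(** Local reflexivity of [X]: a finite rank operator [X -> Y^{**}] acts on
    [Y^* (x) X^{**}] with the norm that it has on [Y^* (x) X]. *)
Lemma second_adjoint_trace_bound (X Y M N : banach)
    (s : seq (dual X * dual (dual Y))) (I : operator M (dual Y))
    (J : operator N (dual (dual X))) (z : tensor M N) : finite_dim N ->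
  rnorm (pairing (@ev R k (dual Y)) (@coev R k (dual X))
      (\sum_(p <- s) tens p.2 p.1) (tensor_map I J z))
    <= ideal_norm B (\sum_(p <- s) rank_one p.1 p.2)
       * opnorm I * opnorm J * alpha z.
Proof.
move=> Nf; set S := \sum_(p <- s) rank_one p.1 p.2.
have BS : in_ideal B S by apply/ideal_finite_rank/finite_rank_sum.
have S0 := ideal_norm_ge0 BS; have I0 := opnorm_ge0 I; have a0 := cross_ge0 al z.
have [t zE] := banach_tensor_decomposition z.
pose f (m : M) : dual X := \sum_(p <- s) (op_fun p.2 (I m) : K) *: p.1.
have fE m : f m = \sum_(p <- s) (op_fun p.2 (I m) : K) *: p.1 by [].
rewrite {1}zE (bidual_pairing_sum J t fE).
set C : R := ideal_norm B S * opnorm I * alpha z.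
have C0 : 0 <= C by rewrite !mulr_ge0.
have -> : ideal_norm B S * opnorm I * opnorm J * alpha z = C * opnorm J.
  by rewrite /C; ring.
apply: (@local_reflexivity R k N X J [seq (q.2, f q.1) | q <- t] _ Nf C0) => U.
rewrite big_map (operator_trace_sum U t fE) -zE.
rewrite (le_trans (ideal_predual_trace_bound alphaP Balpha _ alpha_fg BS))//.
rewrite /C -!mulrA ler_wpM2l// (le_trans (crossnorm_map alphaP _ _ _))//.
by rewrite -mulrA ler_wpM2l// mulrC.
Qed.

(** The duality between the dual and the double dual norm compresses the operator
    to a tensor on finite-dimensional duals, whose dual norm is tested against
    [alpha] itself; by reflexivity these tests are traces on [Y^* (x) X^{**}] and
    fall under [second_adjoint_trace_bound]. *)
Lemma bidual_functional_norm (X Y : banach)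
    (s : seq (dual X * dual (dual Y))) :
  (functional_norm
     (tensor_dual (tensor_dual alpha) (X:=dual Y) (Y:=dual (dual X)))
     (pairing (@ev R k (dual Y)) (@coev R k (dual X))
        (\sum_(p <- s) tens p.2 p.1)%R)
   <= (ideal_norm B (\sum_(p <- s) rank_one p.1 p.2)%R)%:E)%E.
Proof.
pose S : operator X (dual (dual Y)) := \sum_(p <- s) rank_one p.1 p.2.
pose v : tensor (dual (dual Y)) (dual X) := \sum_(p <- s) tens p.2 p.1.
rewrite -/S -/v.
have BS : in_ideal B S by apply/ideal_finite_rank/finite_rank_sum.
have S0 := ideal_norm_ge0 BS.
apply: functional_norm_le => z z1.
rewrite -[ideal_norm B S]mulr1.
apply: le_trans (ler_wpM2l S0 z1); apply: ler_mul_approx => // e e0.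
have d0' (M1 N1 : banach) (w1 : tensor M1 N1) := dual_norm_fin_ge0 w1 al'.
have [M [N [I [J [w [[Mf Nf Ii Ji] [<- we]]]]]]] := finite_hull_approx d0' z e0.
have -> : pairing (@ev R k (dual Y)) (@coev R k (dual X)) v (tensor_map I J w) =
    pairing (@coev R k M) (@coev R k N) w
      (tensor_map (adjoint I) (preadjoint J) v).
  rewrite [RHS]pairing_coevC.
  by rewrite (@pairing_map R k _ _ _ _ _ _ _ _ _ _
    (@ev R k (dual Y)) (@coev R k (dual X)) (adjoint I) (preadjoint J) I J).
rewrite (le_trans (dual_norm_finP _ _ al'))// mulrC.
rewrite ler_pM ?d0' ?(cross_ge0 al')//.
have Mdf := finite_dim_dual Mf; have Ndf := finite_dim_dual Nf.
rewrite (le_trans (tensor_dual_le_fin _ al Mdf Ndf))//.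
apply: (dual_norm_fin_le al) => // t.
have [U U1 UE] := finite_dim_reflexive Mf.
have [V V1 VE] := finite_dim_reflexive Nf.
rewrite (@pairing_map R k _ _ _ _ _ _ _ _ _ _
  (@ev R k (dual Y)) (@coev R k (dual X)) (adjoint I) (preadjoint J)
  (op_comp I U) (op_comp J V)).
- rewrite (le_trans (second_adjoint_trace_bound _ _ _ _ _))//.
    exact: finite_dim_dual.
  rewrite ler_wpM2r ?(cross_ge0 al)// -mulrA ler_piMr//.
  rewrite -[leRHS]mulr1 ler_pM ?opnorm_ge0//.
    rewrite (le_trans (opnorm_comp I U))// -[leRHS]mulr1 ler_pM ?opnorm_ge0//.
    exact: opnorm_isometric.
  rewrite (le_trans (opnorm_comp J V))// -[leRHS]mulr1 ler_pM ?opnorm_ge0//.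
  exact: opnorm_isometric.
- by move=> x F; rewrite -[F in LHS]UE.
- by move=> x F; rewrite -[F in LHS]VE.
Qed.

Lemma predual_pairing_sum (X Y M N : banach) (s : seq (dual Y * X))
    (I : operator M (dual (dual Y))) (J : operator N (dual X))
    (t : seq (M * N)) (f : N -> dual Y) :
  (forall n, f n = \sum_(p <- s) (op_fun (op_fun J n) p.2 : K) *: p.1) ->
  pairing (@coev R k (dual Y)) (@coev R k X) (\sum_(p <- s) tens p.1 p.2)
    (tensor_map I J (\sum_(p <- t) tens p.1 p.2))
  = \sum_(q <- [seq (q.1, f q.2) | q <- t]) op_fun (op_fun I q.1) q.2.
Proof.
move=> fE; rewrite pairing_coevC big_map tensor_map_sum /pairing tensor_sumE.
apply: eq_bigr => q _ /=; rewrite fE functional_sum /pairing_form tensor_sumE.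
by apply: eq_bigr => p _; rewrite /= /form_prod /= mulrC.
Qed.

Lemma space_pairing_sum (X Y M N : banach) (s : seq (dual Y * X))
    (U : operator M Y) (J : operator N (dual X))
    (t : seq (M * N)) (f : N -> dual Y) :
  (forall n, f n = \sum_(p <- s) (op_fun (op_fun J n) p.2 : K) *: p.1) ->
  pairing (@ev R k Y) (@coev R k X) (\sum_(p <- s) tens p.1 p.2)
    (tensor_map U J (\sum_(p <- t) tens p.1 p.2))
  = \sum_(q <- t) op_fun (f q.2) (U q.1).
Proof.
move=> fE; rewrite pairing_evC tensor_map_sum /pairing tensor_sumE.
apply: eq_bigr => q _ /=; rewrite fE op_sumE /pairing_form tensor_sumE.
by apply: eq_bigr => p _; rewrite /= /form_prod /= [LHS]mulrC.
Qed.

(** Local reflexivity of [Y]: a functional on [Y (x) X^*] that comes from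
    [Y^* (x) X] keeps its norm on [Y^{**} (x) X^*]. *)
Lemma bidual_extension_bound (X Y : banach) (u : tensor (dual Y) X) (c : R)
    (v : tensor (dual (dual Y)) (dual X)) : 0 <= c ->
  (functional_norm (tensor_dual alpha (X:=Y) (Y:=dual X))
     (pairing (@ev R k Y) (@coev R k X) u) <= c%:E)%E ->
  rnorm (pairing (@coev R k (dual Y)) (@coev R k X) u v)
    <= c * tensor_dual alpha v.
Proof.
move=> c0 uc; apply: ler_mul_approx => // e e0.
have [M [N [I [J [w [[Mf Nf Ii Ji] [<- we]]]]]]] := finite_hull_approx d0 v e0.
apply: le_trans (ler_wpM2l c0 we).
have [s uE] := banach_tensor_decomposition u.
have [t wE] := banach_tensor_decomposition w.
pose f (n : N) : dual Y := \sum_(p <- s) (op_fun (op_fun J n) p.2 : K) *: p.1.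
have fE n : f n = \sum_(p <- s) (op_fun (op_fun J n) p.2 : K) *: p.1 by [].
rewrite {1}wE uE (predual_pairing_sum I t fE).
have C0 : 0 <= c * dual_norm_fin alpha w by rewrite mulr_ge0 ?d0.
rewrite -[leRHS]mulr1.
apply: le_trans (ler_wpM2l C0 (opnorm_isometric Ii)).
apply: (@local_reflexivity R k M Y I [seq (q.1, f q.2) | q <- t] _ Mf C0) => U.
rewrite big_map -(space_pairing_sum U t fE) -uE -wE.
have := functional_norm_bound (v := tensor_map U J w) c0 (cross_ge0 al' _)
  (crossZ al' (Y:=dual X)) _ uc.
move=> /(_ (pairingZr _ _ u)) /le_trans; apply.
rewrite -mulrA ler_wpM2l// (le_trans (tensor_dual_map _ _ _ alphaP Mf Nf))//.
rewrite mulrAC [leRHS]mulrC ler_piMr ?mulr_ge0 ?opnorm_ge0 ?d0//.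
exact: opnorm_isometric.
Qed.

(** The value [alpha u] is attained by a functional, hence by the trace of an
    operator [T : X -> Y^{**}] in the unit ball of the ideal. Its finite rank
    approximants are tensors of [Y^{**} (x) X^*], on which the approximation
    property of [X^*] turns the ideal norm into the dual tensor norm; the trace
    of [u] with them is then controlled by the functional that [u] defines on
    [Y (x) X^*]. *)
Theorem local_approx_bounded (X : banach) (lambda lambda' : R) :
  0 < lambda -> 0 < lambda' -> maximal_ideal B ->
  local_bounded_approx B lambda X ->
  bounded_approx (tensor_dual alpha) lambda' (dual X) ->
  bounded_approx alpha (lambda * lambda') X.
Proof.
move=> l0 l0' Bmax Xap Xdap Y u.
have ll : 0 < lambda * lambda' by rewrite mulr_gt0.
set F := functional_norm _ _.
have F0 : (0%:E <= F)%E.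
  apply: le_trans (ereal_sup_ubound _); last first.
    by exists 0 => //=; rewrite (cross0 _ _ al').
  by rewrite lee_fin rnorm_ge0.
case FE : F F0 => [c||//] c0; last by rewrite gt0_muley ?leey.
rewrite lee_fin in c0.
rewrite -EFinM lee_fin.
have Fc : (F <= c%:E)%E by rewrite FE.
have [psi [psil psiu psia]] := seminorm_attained u
  (conj (crossnormD alphaP (Y:=X)) (crossnormZ alphaP (Y:=X))).
have [T TE] := operator_of_functional psil psia.
have [|BT T1] := @representing_operator_in_ideal X Y T Bmax.
  by move=> w; rewrite -TE; exact: psia.
rewrite mulrC; apply/ler_addgt0Pr => d dd.
have den : 0 < c * lambda' + 1 by rewrite ltr_wpDl// mulr_ge0// ltW.
(* The total error is [e] from the trace and [c * lambda' * e] from the norm. *)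
have e0 : 0 < d / (c * lambda' + 1) by rewrite divr_gt0.
set e := d / _ in e0.
have [S [Sf SB Su]] := local_approx_trace u Xap BT e0.
have [s SE] := finite_rank_decomposition Sf.
have uS : u (form_comp (op_id (dual Y)) S (@coev R k (dual Y))) =
    pairing (@coev R k (dual Y)) (@coev R k X) u (\sum_(p <- s) tens p.2 p.1).
  rewrite /pairing; apply: tensor_form_ext => f x /=.
  rewrite /pairing_form tensor_sumE SE /form_comp /= /coev !op_sumE.
  by apply: eq_bigr => p _ /=; rewrite /form_prod /= [LHS]mulrC.
have vS : tensor_dual alpha (\sum_(p <- s) tens p.2 p.1) <= lambda' * (lambda + e).
  have := Xdap (dual Y) (\sum_(p <- s) tens p.2 p.1).
  rewrite -lee_fin EFinM => /le_trans; apply.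
  rewrite lee_wpmul2l ?lee_fin ?(ltW l0')//.
  rewrite (le_trans (bidual_functional_norm s))// -SE lee_fin (le_trans SB)//.
  by rewrite lerD2r ler_piMr// ltW.
have uv := bidual_extension_bound (\sum_(p <- s) tens p.2 p.1) c0 Fc.
have a0 := cross_ge0 al u.
have au : alpha u = rnorm (u (form_comp (op_id (dual Y)) T (@coev R k (dual Y)))).
  by rewrite -TE psiu rnorm_scalar rpart_norm_rembed.
rewrite au.
have := rnormD (u (form_comp (op_id (dual Y)) T (@coev R k (dual Y)))
         - u (form_comp (op_id (dual Y)) S (@coev R k (dual Y))))
     (u (form_comp (op_id (dual Y)) S (@coev R k (dual Y)))).
rewrite subrK => /le_trans; apply.
apply: le_trans (lerD Su (le_trans _ (ler_wpM2l c0 vS))) _; first by rewrite uS.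
have eE : e * (c * lambda' + 1) = d by rewrite divfK// gt_eqF.
rewrite -eE le_eqVlt; apply/orP; left; apply/eqP; ring.
Qed.

End LocalToBounded.

Theorem theorem4p1 (R : realType) (k : scalar_kind)
    (A Aadj : banach_ideal R k) (alpha : tensor_family R k)
    (lambda lambda' : R) (X : completeNormedModType (scalar_field R k)) :
  tensor_norm alpha ->
  maximal_ideal A -> associated A alpha ->
  maximal_ideal Aadj -> associated Aadj (tensor_adjoint alpha) ->
  1 <= lambda -> 1 <= lambda' ->
  (bounded_approx alpha lambda X -> local_bounded_approx Aadj lambda X) /\
  (local_bounded_approx Aadj lambda X ->
   bounded_approx (tensor_dual alpha) lambda' (dual X) ->
   bounded_approx alpha (lambda * lambda') X).
Proof.
move=> [alphaP alpha_fg] _ _ Amax Aalpha l1 l1'.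
have l0 := lt_le_trans ltr01 l1; have l0' := lt_le_trans ltr01 l1'.
split; first exact: (bounded_approx_local alphaP alpha_fg Aalpha (ltW l0)).
exact: (local_approx_bounded alphaP alpha_fg Aalpha l0 l0' Amax).
Qed.
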